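(* Let $n\ge 2$, $\gamma\ge 1$, $\kappa>0$, $\rho_+>0$, and let $\sigma$ be any positive constant satisfying $0<\sigma<\sqrt{h'(\rho_+)/\kappa}$. Then there exist a positive constant $\delta$ and a positive constant $C=C(n,\kappa,\rho_+)$ such that the following holds. If $\rho_b\in\mathbb{R}$ satisfies $|\rho_b|<\delta$, then there exists a unique smooth (positive) solution $\tilde\rho:[1,\infty)\to(0,\infty)$ to $$P(\tilde\rho)_r=\kappa\,\tilde\rho\left(\tilde\rho_{rr}+\frac{n-1}{r}\tilde\rho_r\right)_r,\quad r>1,\qquad \tilde\rho_r(1)=\rho_b,\qquad \lim_{r\to\infty}\tilde\rho(r)=\rho_+,$$ satisfying $$|\tilde\rho(r)-\rho_+|\le C|\rho_b|e^{-\sigma r},\qquad r\ge 1.$$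
   Context: This is the stationary problem for the spherically symmetric compressible Navier--Stokes--Korteweg equations on the exterior domain $\{x\in\mathbb{R}^n: |x|>1\}$ with impermeable wall (zero velocity at the boundary, so the stationary velocity vanishes identically). Here $r=|x|$, subscript $r$ denotes $d/dr$, $\tilde\rho$ is the density, the pressure is $P(\rho)=\rho^\gamma$ with fixed $\gamma\ge1$, and $h$ is defined on $(0,\infty)$ by $h(\rho)=\frac{\gamma}{\gamma-1}\rho^{\gamma-1}$ if $\gamma>1$ and $h(\rho)=\log\rho$ if $\gamma=1$, so that $h'(\rho)=P'(\rho)/\rho$. The exponent $\gamma$ is regarded as fixed, and constants may depend on it. *)

(* Defs.v *)
From Stdlib Require Import Reals.
From Coquelicot Require Import Coquelicot.
Open Scope R_scope.

Definition exterior (r : R) : Prop := 1 <= r.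

(* C^infinity up to the boundary: [d k] is the k-th derivative relative to [D]
   ([D_in] only sees difference quotients at points of [D]), so one-sided
   derivatives of all orders are required at boundary points of [D]. *)
Definition smooth_on (D : R -> Prop) (f : R -> R) : Prop :=
  exists d : nat -> R -> R,
    (forall x, D x -> d 0%nat x = f x) /\
    (forall k x, D x -> D_in (d k) (d (S k)) D x).

Definition pressure (gamma rho : R) : R := Rpower rho gamma.

Definition enthalpy (gamma rho : R) : R :=
  if Req_EM_T gamma 1 then ln rho
  else gamma / (gamma - 1) * Rpower rho (gamma - 1).

Definition radial_laplacian (n : nat) (rho : R -> R) (r : R) : R :=
  Derive_n rho 2 r + (INR n - 1) / r * Derive rho r.

(* Functions on [1, +oo) are represented by total functions [R -> R] whose
   values below 1 are irrelevant.  [Derive] is Coquelicot's total derivative;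
   it is applied only at r > 1, where smoothness makes it the true one.  The
   derivative at the wall r = 1 is one-sided. *)
Definition stationary_solution (n : nat) (gamma kappa rho_plus rho_b : R)
    (rho : R -> R) : Prop :=
  smooth_on exterior rho /\
  (forall r, 1 <= r -> 0 < rho r) /\
  (forall r, 1 < r ->
     Derive (fun s => pressure gamma (rho s)) r
     = kappa * rho r * Derive (radial_laplacian n rho) r) /\
  D_in rho (fun _ => rho_b) exterior 1 /\
  is_lim rho p_infty rho_plus.

(* Main.v *)
(* Integrating once, the equation is [kappa * Lap rho = h(rho) - h(rho_plus)], with
   [Lap] the radial Laplacian: another constant of integration would make [Lap rho]
   tend to a nonzero limit and [rho] grow quadratically.  As [h] is increasing,
   the monotonicity of [r^(n-1) w w'] for the difference [w] of two solutions gives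
   uniqueness.  For existence, write
   [rho = rho_plus + u]; since [sigma^2 < h'(rho_plus) / kappa], the functions
   [A exp (- sigma r)] and [- A exp (- sigma r)] are a super- and a subsolution for
   small [A], and shooting on [u(1)] finds a trajectory that stays between them. *)

Require Import Defs.
From Stdlib Require Import Reals Lra Lia IndefiniteDescription.
From Coquelicot Require Import Coquelicot.
Open Scope R_scope.

(** * Fixed points of causal contractions *)

(** In dimension [S N] the flux [p = t^N u'] absorbs the first-order term of the radial Laplacian:
    the equation becomes [u' = p / t^N], [p' = t^N g(u)], with wall datum [p 1 = b]. Shooting has to
    follow every trajectory for all time, also those that leave the strip and might approach zero
    density or blow up. Hence h is composed with a clamp onto an interval around [rho_plus]; the
    resulting [g] is globally Lipschitz and still nondecreasing, and the trajectory finally selected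
    never leaves the region where the clamp is the identity. The critical rate
    [sqrt (h'(rho_plus) / kappa)] is that of the linearised one-dimensional equation; the curvature
    term of the Laplacian has the favourable sign in the barrier inequality. Comparison at the wall
    requires [|b| <= A sigma exp (- sigma)], and [A = C |b|] then makes the decay bound linear in
    [b]. This condition would force [C] to blow up as [sigma] tends to 0, so small rates are first
    raised to half the critical one; this is how [C] can be chosen before [sigma]. *)

Lemma half_pow_eps (K eps : R) : 0 <= K -> 0 < eps ->
  exists k : nat, K * (1 / 2) ^ k < eps.
Proof.
  intros HK He.
  assert (H1 : Rabs (1 / 2) < 1) by (rewrite Rabs_right; lra).
  destruct (pow_lt_1_zero (1 / 2) H1 (eps / (K + 1))) as [k Hk].
  { apply Rdiv_lt_0_compat; lra. }
  exists k. specialize (Hk k (Nat.le_refl k)).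
  rewrite Rabs_right in Hk by (apply Rle_ge, pow_le; lra).
  apply (Rmult_lt_compat_l (K + 1)) in Hk; [|lra].
  replace ((K + 1) * (eps / (K + 1))) with eps in Hk by (field; lra).
  assert (0 < (1 / 2) ^ k) by (apply pow_lt; lra). nra.
Qed.

Lemma le_half_pow_le0 (x K : R) : 0 <= K ->
  (forall k : nat, x <= K * (1 / 2) ^ k) -> x <= 0.
Proof.
  intros HK H. destruct (Rle_lt_dec x 0) as [|Hx]; [assumption|].
  destruct (half_pow_eps K x HK Hx) as [k Hk]. specialize (H k). lra.
Qed.

(** The limit is produced before [K] is quantified. Later every bounded interval brings its own [K],
    and the pointwise limit must not depend on that interval. *)
Lemma geometric_limit (x : nat -> R) :
  (exists K, forall k, Rabs (x (S k) - x k) <= K * (1 / 2) ^ k) ->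
  exists l, forall K, (forall k, Rabs (x (S k) - x k) <= K * (1 / 2) ^ k) ->
    forall k, Rabs (l - x k) <= 2 * K * (1 / 2) ^ k.
Proof.
  assert (Htel : forall K, (forall k, Rabs (x (S k) - x k) <= K * (1 / 2) ^ k) ->
    forall k j, Rabs (x (k + j)%nat - x k) <= 2 * K * ((1 / 2) ^ k - (1 / 2) ^ (k + j))).
  { intros K HK k j. induction j as [|j IH].
    - rewrite Nat.add_0_r. unfold Rminus. rewrite !Rplus_opp_r, Rabs_R0. lra.
    - rewrite Nat.add_succ_r.
      replace (x (S (k + j)) - x k) with ((x (S (k + j)) - x (k + j)%nat) + (x (k + j)%nat - x k)) by ring.
      eapply Rle_trans; [apply Rabs_triang|].
      specialize (HK (k + j)%nat). simpl pow. lra. }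
  intros [K0 HK0].
  assert (K0pos : 0 <= K0).
  { specialize (HK0 0%nat). simpl in HK0. pose proof (Rabs_pos (x 1%nat - x 0%nat)). lra. }
  assert (HC : Cauchy_crit x).
  { intros eps He. destruct (half_pow_eps (4 * K0) eps) as [k Hk]; [lra|lra|].
    exists k. intros n m Hn Hm. unfold Rdist.
    pose proof (Htel K0 HK0 k (n - k)%nat) as Tn. pose proof (Htel K0 HK0 k (m - k)%nat) as Tm.
    replace (k + (n - k))%nat with n in Tn by lia. replace (k + (m - k))%nat with m in Tm by lia.
    assert (0 < (1 / 2) ^ n) by (apply pow_lt; lra).
    assert (0 < (1 / 2) ^ m) by (apply pow_lt; lra).
    replace (x n - x m) with ((x n - x k) - (x m - x k)) by ring.
    eapply Rle_lt_trans; [apply Rabs_triang|]. rewrite Rabs_Ropp. nra. }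
  destruct (Rcomplete.R_complete x HC) as [l Hl]. exists l. intros K HK k.
  apply Rnot_lt_le. intros Hlt.
  destruct (Hl (Rabs (l - x k) - 2 * K * (1 / 2) ^ k)) as [n Hn]; [lra|].
  specialize (Hn (k + n)%nat ltac:(lia)). unfold Rdist in Hn.
  pose proof (Htel K HK k n) as T.
  assert (0 <= K).
  { specialize (HK 0%nat). simpl in HK. pose proof (Rabs_pos (x 1%nat - x 0%nat)). lra. }
  assert (0 < (1 / 2) ^ (k + n)) by (apply pow_lt; lra).
  pose proof (Rabs_triang (x (k + n)%nat - x k) (l - x (k + n)%nat)) as T2.
  rewrite (Rabs_minus_sym l (x (k + n)%nat)) in T2.
  replace (x (k + n)%nat - x k + (l - x (k + n)%nat)) with (l - x k) in T2 by ring.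
  nra.
Qed.

(** Composition with [Rmax a] extends a function from the half line by its value at [a], so that
    continuity can be stated on all of [R]. *)
Lemma continuous_Rmax_l (a x : R) : continuous (fun t => Rmax a t) x.
Proof.
  apply continuous_ext with (fun t => / 2 * (a + t + Rabs (t - a))).
  { intros t. unfold Rmax, Rabs. destruct (Rle_dec a t); destruct (Rcase_abs (t - a)); lra. }
  apply (continuous_scal_r (/ 2) (fun t => a + t + Rabs (t - a))).
  apply (continuous_plus (fun t => a + t)).
  - apply (continuous_plus (fun _ => a)); [apply continuous_const|apply continuous_id].
  - apply (continuous_comp (fun t => t - a) Rabs).
    + apply (continuous_minus (V := R_NormedModule) (fun t => t) (fun _ => a)); [apply continuous_id|apply continuous_const].
    + apply continuous_Rabs.
Qed.

Lemma continuous_eps (f : R -> R) (x : R) :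
  continuous f x <->
  forall eps, 0 < eps -> exists d, 0 < d /\ forall y, Rabs (y - x) < d -> Rabs (f y - f x) < eps.
Proof.
  split.
  - intros H eps He. apply filterlim_locally with (eps := mkposreal eps He) in H.
    destruct H as [d Hd]. exists d. split; [apply cond_pos|].
    intros y Hy. apply (Hd y Hy).
  - intros H. apply filterlim_locally. intros eps.
    destruct (H eps (cond_pos eps)) as [d [Hd H']]. exists (mkposreal d Hd).
    intros y Hy. apply H', Hy.
Qed.

Lemma continuous_bounded (f : R -> R) (a X : R) :
  (forall t, continuous f t) -> exists M, 0 <= M /\ forall t, a <= t <= X -> Rabs (f t) <= M.
Proof.
  intros Hf. destruct (Rle_lt_dec a X) as [HX|HX].
  - destruct (continuity_ab_maj (fun t => Rabs (f t)) a X HX) as [c [Hc _]].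
    { intros t _. apply continuity_pt_filterlim.
      apply (continuous_comp f Rabs); [apply Hf|apply continuous_Rabs]. }
    exists (Rabs (f c)). split; [apply Rabs_pos|]. exact Hc.
  - exists 0. split; intros; lra.
Qed.

(* Banach's fixed point argument for a causal operator: the contraction
   estimate on [a, X] only involves values on [a, X], so the Picard iterates
   converge uniformly on each bounded interval although the weighted distance
   between them may be infinite on the whole half line. *)
Lemma causal_contraction_fixpoint (a : R) (W : R -> R) (T : (R -> R) -> R -> R) :
  (forall t, continuous W t) -> (forall t, a <= t -> 1 <= W t) ->
  (forall u, (forall t, continuous u t) -> forall t, continuous (T u) t) ->
  (forall u v X M, (forall t, continuous u t) -> (forall t, continuous v t) ->
     (forall t, a <= t <= X -> Rabs (u t - v t) <= M * W t) ->
     forall t, a <= t <= X -> Rabs (T u t - T v t) <= M / 2 * W t) ->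
  exists u, (forall t, continuous u t) /\ forall t, a <= t -> T u t = u t.
Proof.
  intros HWc HW1 HTc HTl.
  set (y := fix y (k : nat) : R -> R := match k with O => fun _ => 0 | S k => T (y k) end).
  assert (Hyc : forall k t, continuous (y k) t).
  { intros k. induction k as [|k IH]; intros t; [apply continuous_const|].
    simpl. apply HTc, IH. }
  assert (Hstep : forall X, exists K, 0 <= K /\ forall k t, a <= t <= X ->
     Rabs (y (S k) t - y k t) <= K * (1 / 2) ^ k).
  { intros X.
    destruct (continuous_bounded (T (y 0%nat)) a X) as [M [HM0 HM]]; [apply HTc, Hyc|].
    destruct (continuous_bounded W a X HWc) as [B [HB0 HB]].
    exists (M * B). split; [nra|].
    assert (H : forall k t, a <= t <= X -> Rabs (y (S k) t - y k t) <= M * (1 / 2) ^ k * W t).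
    { intros k. induction k as [|k IH]; intros t Ht.
      - simpl. unfold Rminus. rewrite Ropp_0, Rplus_0_r.
        pose proof (HW1 t (proj1 Ht)). specialize (HM t Ht). simpl in HM. nra.
      - replace (M * (1 / 2) ^ S k) with (M * (1 / 2) ^ k / 2) by (simpl; field).
        apply (HTl (y (S k)) (y k) X); auto. }
    intros k t Ht. specialize (H k t Ht). specialize (HB t Ht).
    pose proof (Rle_abs (W t)).
    assert (0 <= M * (1 / 2) ^ k) by (apply Rmult_le_pos; [lra|apply pow_le; lra]).
    apply Rle_trans with (1 := H). replace (M * B * (1 / 2) ^ k) with (M * (1 / 2) ^ k * B) by ring.
    apply Rmult_le_compat_l; lra. }
  (* The condition [a <= t] stands under the existential, so that a limit exists for every real [t]
     and the choice principle applies. *)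
  assert (Hlim : forall t, exists l, a <= t -> forall K,
     (forall k, Rabs (y (S k) t - y k t) <= K * (1 / 2) ^ k) ->
     forall k, Rabs (l - y k t) <= 2 * K * (1 / 2) ^ k).
  { intros t. destruct (Rle_lt_dec a t) as [Ht|Ht].
    - destruct (geometric_limit (fun k => y k t)) as [l Hl].
      + destruct (Hstep t) as [K [_ HK]]. exists K. intros k. apply HK; lra.
      + exists l. intros _. exact Hl.
    - exists 0. intros; lra. }
  destruct (functional_choice _ Hlim) as [l Hl].
  assert (Hunif : forall X, exists K, 0 <= K /\ forall k t, a <= t <= X ->
     Rabs (l t - y k t) <= K * (1 / 2) ^ k).
  { intros X. destruct (Hstep X) as [K [HK0 HK]]. exists (2 * K). split; [lra|].
    intros k t Ht. apply (Hl t (proj1 Ht)). intros j. apply HK, Ht. }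
  (* An [eps / 3] argument: one more unit beyond [Rmax a t] gives a bounded interval that contains a
     neighbourhood of the point and carries a uniform estimate. *)
  assert (Hcont : forall t, continuous (fun t => l (Rmax a t)) t).
  { intros t. apply continuous_eps. intros eps He.
    destruct (Hunif (Rmax a t + 1)) as [K [HK0 HK]].
    destruct (half_pow_eps K (eps / 3)) as [k Hk]; [lra|lra|].
    assert (Hc : continuous (fun t => y k (Rmax a t)) t).
    { apply (continuous_comp (fun t => Rmax a t) (y k)); [apply continuous_Rmax_l|apply Hyc]. }
    rewrite continuous_eps in Hc. destruct (Hc (eps / 3) ltac:(lra)) as [d [Hd Hy]].
    exists (Rmin d 1). split; [apply Rmin_pos; lra|]. intros s Hs.
    specialize (Hy s (Rlt_le_trans _ _ _ Hs (Rmin_l _ _))). pose proof (Rlt_le_trans _ _ _ Hs (Rmin_r _ _)) as Hs1.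
    assert (Hs2 : a <= Rmax a s <= Rmax a t + 1).
    { split; [apply Rmax_l|]. apply Rabs_def2 in Hs1.
      pose proof (Rmax_l a t). pose proof (Rmax_r a t). apply Rmax_lub; lra. }
    pose proof (HK k _ Hs2) as K1.
    assert (Ht2 : a <= Rmax a t <= Rmax a t + 1) by (split; [apply Rmax_l|lra]).
    pose proof (HK k _ Ht2) as K2.
    apply Rabs_def1; apply Rabs_def2 in Hy; apply Rabs_le_between in K1, K2; lra. }
  exists (fun t => l (Rmax a t)). split; [exact Hcont|].
  intros t Ht. rewrite Rmax_right by assumption.
  destruct (Hunif t) as [K [HK0 HK]]. pose proof (HW1 t Ht) as HWt.
  (* Compare both terms with the iterate of index [S k], which is [T (y k)]: the defect of the limit
     is at most a constant times [(1 / 2) ^ k] for every [k]. *)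
  assert (Habs : Rabs (T (fun t => l (Rmax a t)) t - l t) <= 0).
  { apply le_half_pow_le0 with (K * W t + K); [nra|]. intros k.
    assert (H1 : Rabs (T (fun t => l (Rmax a t)) t - T (y k) t) <= (K * (1 / 2) ^ k) / 2 * W t).
    { apply (HTl (fun t => l (Rmax a t)) (y k) t); auto; [|lra].
      intros s Hs. rewrite Rmax_right by lra. specialize (HK k s Hs). pose proof (HW1 s (proj1 Hs)).
      pose proof (Rabs_pos (l s - y k s)). nra. }
    pose proof (HK (S k) t ltac:(lra)) as H2. simpl in H2.
    assert (0 < (1 / 2) ^ k) by (apply pow_lt; lra).
    assert (0 <= K * (1 / 2) ^ k) by nra.
    assert (0 <= K * (1 / 2) ^ k * W t) by nra.
    replace (T (fun t => l (Rmax a t)) t - l t) with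
      ((T (fun t => l (Rmax a t)) t - T (y k) t) - (l t - T (y k) t)) by ring.
    eapply Rle_trans; [apply Rabs_triang|]. rewrite Rabs_Ropp. nra. }
  pose proof (Rabs_pos (T (fun t => l (Rmax a t)) t - l t)).
  apply Rminus_diag_uniq. apply Rabs_eq_0. lra.
Qed.

(** * The radial initial value problem *)

Lemma is_derive_continuous (f : R -> R) (x l : R) : is_derive f x l -> continuous f x.
Proof. intros H. apply (ex_derive_continuous f). exists l. exact H. Qed.

Lemma nonneg_derive_le (f df : R -> R) (a b : R) : a <= b ->
  (forall x, a <= x <= b -> continuous f x) ->
  (forall x, a < x < b -> is_derive f x (df x)) ->
  (forall x, a < x < b -> 0 <= df x) -> f a <= f b.
Proof.
  intros Hab Hc Hd Hp. destruct (Req_dec a b) as [<-|Hne]; [lra|].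
  (* The intermediate point may be an endpoint, where nothing is known about [df]. The truncated
     derivative agrees with [df] inside and is nonnegative everywhere. *)
  destruct (MVT_gen f a b (fun x => Rmax 0 (df x))) as [c [_ Hf]].
  - intros x. rewrite Rmin_left, Rmax_right by lra. intros Hx.
    rewrite Rmax_right by (apply Hp, Hx). apply Hd, Hx.
  - intros x. rewrite Rmin_left, Rmax_right by lra. intros Hx.
    apply continuity_pt_filterlim, Hc, Hx.
  - pose proof (Rmax_l 0 (df c)). nra.
Qed.

(** Mean value inequality with a majorant: [g - f] and [g + f] are both nondecreasing. *)
Lemma derive_bound (f df g dg : R -> R) (a b : R) : a <= b ->
  (forall x, a <= x <= b -> is_derive f x (df x)) ->
  (forall x, a <= x <= b -> is_derive g x (dg x)) ->
  (forall x, a <= x <= b -> Rabs (df x) <= dg x) -> Rabs (f b - f a) <= g b - g a.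
Proof.
  intros Hab Hf Hg H.
  assert (H1 : g a - f a <= g b - f b).
  { apply (nonneg_derive_le (fun x => g x - f x) (fun x => dg x - df x)); [assumption| | |].
    - intros x Hx. apply is_derive_continuous with (dg x - df x). apply (is_derive_minus (V := R_NormedModule)); auto.
    - intros x Hx. apply (is_derive_minus (V := R_NormedModule)); [apply Hg|apply Hf]; lra.
    - intros x Hx. assert (Hx' : a <= x <= b) by lra.
      specialize (H x Hx'). apply Rabs_le_between in H. lra. }
  assert (H2 : g a + f a <= g b + f b).
  { apply (nonneg_derive_le (fun x => g x + f x) (fun x => dg x + df x)); [assumption| | |].
    - intros x Hx. apply is_derive_continuous with (dg x + df x). apply (is_derive_plus (V := R_NormedModule)); auto.
    - intros x Hx. apply (is_derive_plus (V := R_NormedModule)); [apply Hg|apply Hf]; lra.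
    - intros x Hx. assert (Hx' : a <= x <= b) by lra.
      specialize (H x Hx'). apply Rabs_le_between in H. lra. }
  apply Rabs_le_between. lra.
Qed.

Lemma is_derive_primitive (f : R -> R) (c a t : R) : (forall t, continuous f t) ->
  is_derive (fun t => c + RInt f a t) t (f t).
Proof.
  intros Hf. replace (f t) with (0 + f t) by ring.
  apply (is_derive_plus (V := R_NormedModule) (fun _ => c)).
  - apply (is_derive_const (V := R_NormedModule)).
  - apply (is_derive_RInt f (fun t => RInt f a t) a).
    + apply filter_forall. intros x. apply (RInt_correct (V := R_CompleteNormedModule)).
      apply (ex_RInt_continuous (V := R_CompleteNormedModule)). auto.
    + apply Hf.
Qed.

Lemma lipschitz_continuous (g : R -> R) (L : R) :
  (forall x y, Rabs (g x - g y) <= L * Rabs (x - y)) -> forall x, continuous g x.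
Proof.
  intros HL x. apply continuous_eps. intros eps He.
  assert (H0 : 0 <= Rabs L) by apply Rabs_pos.
  exists (eps / (Rabs L + 1)). split; [apply Rdiv_lt_0_compat; lra|].
  intros y Hy. specialize (HL y x). apply Rle_lt_trans with (1 := HL).
  apply (Rmult_lt_compat_r (Rabs L + 1)) in Hy; [|lra].
  replace (eps / (Rabs L + 1) * (Rabs L + 1)) with eps in Hy by (field; lra).
  pose proof (Rle_abs L). pose proof (Rabs_pos (y - x)). nra.
Qed.

Lemma is_derive_exp_scal (c l t : R) : is_derive (fun t => c * exp (l * t)) t (l * c * exp (l * t)).
Proof. auto_derive; [trivial|ring]. Qed.

(** Picard iteration on [u] alone, the flux being recovered by integration. In the weight
    [exp ((L + 1) t)] each of the two integrations gains a factor [1 / (L + 1)], so the map has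
    constant [L / (L + 1)^2], which is below [1 / 2]. *)
Lemma radial_ivp (N : nat) (g : R -> R) (L s b : R) : 0 <= L ->
  (forall x y, Rabs (g x - g y) <= L * Rabs (x - y)) ->
  exists u p : R -> R, u 1 = s /\ p 1 = b /\
    forall t, 1 <= t -> is_derive u t (p t / t ^ N) /\ is_derive p t (t ^ N * g (u t)).
Proof.
  intros HL Hg.
  (* Freezing the weight at its wall value for [t < 1] keeps it continuous and at least 1 on all of
     [R], so division by it is harmless. *)
  set (w := fun t => Rmax 1 t ^ N).
  assert (Hw1 : forall t, 1 <= w t).
  { intros t. apply pow_R1_Rle, Rmax_l. }
  assert (Hwc : forall t, continuous w t).
  { intros t. apply (continuous_comp (fun t => Rmax 1 t) (fun x => x ^ N)); [apply continuous_Rmax_l|].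
    apply (ex_derive_continuous (fun x => x ^ N)). auto_derive. trivial. }
  assert (Hwt : forall t, 1 <= t -> w t = t ^ N).
  { intros t Ht. unfold w. rewrite Rmax_right by assumption. reflexivity. }
  set (flux := fun (u : R -> R) t => b + RInt (fun t => w t * g (u t)) 1 t).
  assert (Hgu : forall u, (forall t, continuous u t) -> forall t, continuous (fun t => w t * g (u t)) t).
  { intros u Hu t. apply (continuous_mult (K := R_AbsRing) w (fun t => g (u t))); [apply Hwc|].
    apply (continuous_comp u g); [apply Hu|apply lipschitz_continuous with L; exact Hg]. }
  assert (Hflux : forall u, (forall t, continuous u t) -> forall t, is_derive (flux u) t (w t * g (u t))).
  { intros u Hu t. apply (is_derive_primitive (fun t => w t * g (u t))). auto. }
  assert (Hslope : forall u, (forall t, continuous u t) -> forall t, continuous (fun t => flux u t / w t) t).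
  { intros u Hu t. apply (continuous_mult (K := R_AbsRing) (flux u) (fun t => / w t)).
    - apply is_derive_continuous with (w t * g (u t)). auto.
    - apply (continuous_comp w Rinv); [apply Hwc|]. apply continuous_Rinv. specialize (Hw1 t). lra. }
  set (prim := fun (u : R -> R) t => s + RInt (fun t => flux u t / w t) 1 t).
  assert (Hprim : forall u, (forall t, continuous u t) -> forall t, is_derive (prim u) t (flux u t / w t)).
  { intros u Hu t. apply (is_derive_primitive (fun t => flux u t / w t)). auto. }
  destruct (causal_contraction_fixpoint 1 (fun t => exp ((L + 1) * t)) (fun u t => prim u (Rmax 1 t)))
    as [u [Hu Hfix]].
  - intros t. apply (ex_derive_continuous (fun t => exp ((L + 1) * t))). auto_derive. trivial.
  - intros t Ht. pose proof (exp_ineq1_le ((L + 1) * t)). nra.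
  - intros u Hu t. apply (continuous_comp (fun t => Rmax 1 t) (prim u)); [apply continuous_Rmax_l|].
    apply is_derive_continuous with (flux u (Rmax 1 t) / w (Rmax 1 t)). auto.
  - intros u v X M Hu Hv Huv t Ht. rewrite Rmax_right by lra.
    assert (HM : 0 <= M).
    { specialize (Huv t Ht). pose proof (Rabs_pos (u t - v t)). pose proof (exp_pos ((L + 1) * t)). nra. }
    (* The weight is nondecreasing, so under the integral it is bounded by its value at the endpoint
       [r]; this factor cancels in [flux / w]. *)
    assert (Hfl : forall r, 1 <= r <= X -> Rabs (flux u r - flux v r) <= w r * (L * M / (L + 1) * exp ((L + 1) * r))).
    { intros r Hr.
      pose proof (derive_bound (fun t => flux u t - flux v t) (fun t => w t * g (u t) - w t * g (v t))
        (fun t => w r * L * M / (L + 1) * exp ((L + 1) * t)) (fun t => (L + 1) * (w r * L * M / (L + 1)) * exp ((L + 1) * t)) 1 r) as D.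
      assert (E1 : forall u, flux u 1 = b).
      { intros u'. unfold flux. rewrite RInt_point. unfold zero; simpl. ring. }
      cbv beta in D. rewrite !E1 in D.
      assert (0 <= w r * L * M / (L + 1) * exp ((L + 1) * 1)).
      { apply Rmult_le_pos; [|left; apply exp_pos]. apply Rdiv_le_0_compat; [|lra].
        specialize (Hw1 r). apply Rmult_le_pos; [apply Rmult_le_pos|]; lra. }
      replace (w r * (L * M / (L + 1) * exp ((L + 1) * r))) with (w r * L * M / (L + 1) * exp ((L + 1) * r)) by (field; lra).
      replace (flux u r - flux v r) with (flux u r - flux v r - (b - b)) by ring.
      apply Rle_trans with (w r * L * M / (L + 1) * exp ((L + 1) * r) - w r * L * M / (L + 1) * exp ((L + 1) * 1)); [|lra].
      apply D.
      - lra.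
      - intros x Hx. apply (is_derive_minus (V := R_NormedModule)); auto.
      - intros x Hx. apply is_derive_exp_scal.
      - intros x Hx. specialize (Huv x ltac:(lra)). specialize (Hg (u x) (v x)).
        replace (w x * g (u x) - w x * g (v x)) with (w x * (g (u x) - g (v x))) by ring.
        rewrite Rabs_mult, (Rabs_right (w x)) by (specialize (Hw1 x); lra).
        replace ((L + 1) * (w r * L * M / (L + 1)) * exp ((L + 1) * x)) with (w r * (L * (M * exp ((L + 1) * x)))) by (field; lra).
        apply Rmult_le_compat; [specialize (Hw1 x); lra|apply Rabs_pos| |].
        + rewrite !Hwt by lra. apply pow_incr. lra.
        + apply Rle_trans with (1 := Hg). apply Rmult_le_compat_l; assumption. }
    pose proof (derive_bound (fun t => prim u t - prim v t) (fun t => flux u t / w t - flux v t / w t)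
      (fun t => M / 2 * exp ((L + 1) * t)) (fun t => (L + 1) * (M / 2) * exp ((L + 1) * t)) 1 t) as D.
    assert (E1 : forall u, prim u 1 = s).
    { intros u'. unfold prim. rewrite RInt_point. unfold zero; simpl. ring. }
    cbv beta in D. rewrite !E1 in D.
    assert (0 <= M / 2 * exp ((L + 1) * 1)).
    { apply Rmult_le_pos; [lra|left; apply exp_pos]. }
    replace (prim u t - prim v t) with (prim u t - prim v t - (s - s)) by ring.
    apply Rle_trans with (M / 2 * exp ((L + 1) * t) - M / 2 * exp ((L + 1) * 1)); [|lra].
    apply D.
    + lra.
    + intros x Hx. apply (is_derive_minus (V := R_NormedModule)); auto.
    + intros x Hx. apply is_derive_exp_scal.
    + intros x Hx. specialize (Hfl x ltac:(lra)). pose proof (Hw1 x) as Hwx.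
      replace (flux u x / w x - flux v x / w x) with (/ w x * (flux u x - flux v x)) by (field; lra).
      rewrite Rabs_mult, Rabs_inv, (Rabs_right (w x)) by lra.
      apply Rle_trans with (/ w x * (w x * (L * M / (L + 1) * exp ((L + 1) * x)))).
      { apply Rmult_le_compat_l; [|exact Hfl]. left. apply Rinv_0_lt_compat. lra. }
      rewrite <- Rmult_assoc, Rinv_l, Rmult_1_l by lra.
      apply Rmult_le_compat_r; [left; apply exp_pos|].
      apply (Rmult_le_reg_r (L + 1)); [lra|].
      replace (L * M / (L + 1) * (L + 1)) with (L * M) by (field; lra). nra.
  (* The fixed point identity holds only for [t >= 1], and [u] may have a corner at the wall.
     [prim u] agrees with [u] on the half line and has a two-sided derivative at 1. *)
  - exists (prim u), (flux u).
    assert (E : forall t, 1 <= t -> prim u t = u t).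
    { intros t Ht. rewrite <- Hfix by assumption. rewrite Rmax_right by assumption. reflexivity. }
    split; [unfold prim; rewrite RInt_point; unfold zero; simpl; ring|].
    split; [unfold flux; rewrite RInt_point; unfold zero; simpl; ring|].
    intros t Ht. rewrite <- (Hwt t Ht), (E t Ht). auto.
Qed.

(** * Comparison with barriers and shooting *)

(** Flux form of [u'' + (N / t) u' = g(u)]. The derivatives are two-sided even at [t = 1], so a flow
    carries an extension slightly beyond the wall. *)
Definition radial_flow (N : nat) (g u p : R -> R) : Prop :=
  forall t, 1 <= t -> is_derive u t (p t / t ^ N) /\ is_derive p t (t ^ N * g (u t)).

(* [is_derive_unique] with the domain typed [R], which is the form left by [auto_derive]. *)
Lemma Derive_eq (f : R -> R) (x l : R) : is_derive f x l -> Derive (fun y : R => f y) x = l.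
Proof. apply is_derive_unique. Qed.

(** Gronwall for the energy [w^2 + z^2] of the difference, with [z] the difference of slopes. The
    damping term contributes [- 2 (N / t) z^2], which is nonpositive; the rest is at most [(1 + L)]
    times the energy. *)
Lemma radial_flow_dependence (N : nat) (g : R -> R) (L : R) (u1 p1 u2 p2 : R -> R) : 0 <= L ->
  (forall x y, Rabs (g x - g y) <= L * Rabs (x - y)) ->
  radial_flow N g u1 p1 -> radial_flow N g u2 p2 -> p1 1 = p2 1 ->
  forall t, 1 <= t -> Rabs (u1 t - u2 t) <= Rabs (u1 1 - u2 1) * exp ((1 + L) * (t - 1)).
Proof.
  intros HL Hg H1 H2 Hp t Ht.
  set (w := fun t => u1 t - u2 t). set (z := fun t => (p1 t - p2 t) / t ^ N).
  set (dz := fun t => g (u1 t) - g (u2 t) - INR N / t * z t).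
  assert (Hw : forall t, 1 <= t -> is_derive w t (z t)).
  { intros r Hr. destruct (H1 r Hr) as [A1 _]. destruct (H2 r Hr) as [A2 _].
    unfold z. replace ((p1 r - p2 r) / r ^ N) with (p1 r / r ^ N - p2 r / r ^ N) by (unfold Rdiv; ring).
    apply (is_derive_minus (V := R_NormedModule)); assumption. }
  assert (Hz : forall t, 1 <= t -> is_derive z t (dz t)).
  { intros r Hr. destruct (H1 r Hr) as [_ A1]. destruct (H2 r Hr) as [_ A2].
    assert (Hr0 : r ^ N <> 0) by (apply pow_nonzero; lra).
    unfold z. auto_derive.
    - repeat split; trivial; [exists (r ^ N * g (u1 r))|exists (r ^ N * g (u2 r))]; assumption.
    - rewrite (Derive_eq p1 _ _ A1), (Derive_eq p2 _ _ A2).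
      unfold dz, z. destruct N as [|N]; simpl; field; simpl in Hr0; repeat split; try lra.
      apply pow_nonzero; lra. }
  (* The minus sign turns the decrease of the discounted energy into an increase, as the
     monotonicity lemma expects. *)
  set (E := fun t => - ((w t * w t + z t * z t) * exp (- (1 + L) * (t - 1)))).
  set (dE := fun t => ((1 + L) * (w t * w t + z t * z t) - 2 * (w t * z t + z t * dz t)) * exp (- (1 + L) * (t - 1))).
  assert (HE : forall t, 1 <= t -> is_derive E t (dE t)).
  { intros r Hr. pose proof (Hw r Hr) as A1. pose proof (Hz r Hr) as A2.
    unfold E. auto_derive.
    - repeat split; trivial; [exists (z r)|exists (z r)|exists (dz r)|exists (dz r)]; assumption.
    - rewrite (Derive_eq w _ _ A1), (Derive_eq z _ _ A2).
      unfold dE, Rminus. ring. }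
  assert (Hle : E 1 <= E t).
  { apply nonneg_derive_le with dE; [assumption| | |].
    - intros x Hx. apply is_derive_continuous with (dE x). apply HE; lra.
    - intros x Hx. apply HE; lra.
    - intros x Hx. apply Rmult_le_pos; [|left; apply exp_pos].
      unfold dz.
      assert (HN : 0 <= INR N / x) by (apply Rdiv_le_0_compat; [apply pos_INR|lra]).
      specialize (Hg (u1 x) (u2 x)). fold (w x) in Hg.
      assert (A : z x * (g (u1 x) - g (u2 x)) <= L * (w x * w x + z x * z x) / 2).
      { apply Rle_trans with (Rabs (z x) * (L * Rabs (w x))).
        - apply Rle_trans with (1 := Rle_abs _). rewrite Rabs_mult.
          apply Rmult_le_compat_l; [apply Rabs_pos|exact Hg].
        - rewrite <- (Rabs_pos_eq (w x * w x)), <- (Rabs_pos_eq (z x * z x)), !Rabs_mult by apply Rle_0_sqr.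
          pose proof (Rle_0_sqr (Rabs (w x) - Rabs (z x))). unfold Rsqr in *. nra. }
      assert (B : 2 * (w x * z x) <= w x * w x + z x * z x).
      { pose proof (Rle_0_sqr (w x - z x)). unfold Rsqr in *. lra. }
      assert (C : 0 <= INR N / x * (z x * z x)) by (apply Rmult_le_pos; [exact HN|apply Rle_0_sqr]).
      lra. }
  assert (Hz1 : z 1 = 0) by (unfold z; rewrite Hp; unfold Rdiv; ring).
  unfold E in Hle. rewrite Hz1, Rminus_diag, !Rmult_0_r, exp_0 in Hle.
  set (e := exp ((1 + L) * (t - 1))).
  assert (Hee : exp (- (1 + L) * (t - 1)) * e = 1).
  { unfold e. rewrite <- exp_plus, <- exp_0. f_equal. ring. }
  assert (He1 : 1 <= e).
  { unfold e. pose proof (exp_ineq1_le ((1 + L) * (t - 1))). nra. }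
  set (e' := exp (- (1 + L) * (t - 1))) in *.
  assert (Hfin : w t * w t <= w 1 * w 1 * e).
  { pose proof (Rle_0_sqr (z t)). unfold Rsqr in *.
    assert (X : (w t * w t + z t * z t) * e' * e <= w 1 * w 1 * e) by (apply Rmult_le_compat_r; lra).
    rewrite Rmult_assoc, Hee in X. lra. }
  fold (w t). change (u1 1 - u2 1) with (w 1).
  (* The energy gives [w^2 <= w(1)^2 e]; since [1 <= e] this is weakened to [(w(1) e)^2] in order to
     take roots. *)
  rewrite <- (Rabs_pos_eq e), <- Rabs_mult by lra. apply Rsqr_le_abs_0. unfold Rsqr.
  pose proof (Rle_0_sqr (w 1)). unfold Rsqr in *. nra.
Qed.

(** Squaring removes the kink of the positive part at 0. The maximum principle can then be run by
    differentiation, without locating a first exit time. *)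
Lemma is_derive_sqr_pos_part (x : R) : is_derive (fun x => Rmax 0 x * Rmax 0 x) x (2 * Rmax 0 x).
Proof.
  apply is_derive_Reals. intros eps He. exists (mkposreal eps He). simpl. intros h Hh Hhe.
  assert (Hq : Rabs (Rmax 0 (x + h) * Rmax 0 (x + h) - Rmax 0 x * Rmax 0 x - 2 * Rmax 0 x * h) <= h * h).
  { unfold Rmax. destruct (Rle_dec 0 (x + h)), (Rle_dec 0 x); apply Rabs_le_between; nra. }
  replace ((Rmax 0 (x + h) * Rmax 0 (x + h) - Rmax 0 x * Rmax 0 x) / h - 2 * Rmax 0 x)
    with ((Rmax 0 (x + h) * Rmax 0 (x + h) - Rmax 0 x * Rmax 0 x - 2 * Rmax 0 x * h) / h) by (field; exact Hh).
  unfold Rdiv. rewrite Rabs_mult, Rabs_inv.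
  apply Rle_lt_trans with (2 := Hhe).
  assert (0 < Rabs h) by (apply Rabs_pos_lt, Hh).
  apply (Rmult_le_reg_r (Rabs h)); [assumption|].
  rewrite Rmult_assoc, Rinv_l, Rmult_1_r by lra.
  rewrite <- Rabs_mult, (Rabs_pos_eq (h * h)) by apply Rle_0_sqr. exact Hq.
Qed.

(* With [m = max 0 w], both [m^2 q] and then [m^2] are nondecreasing. *)
Lemma positivity_persists (N : nat) (w q dq : R -> R) (r0 r : R) :
  (forall t, 1 <= t -> is_derive w t (q t / t ^ N)) ->
  (forall t, 1 <= t -> is_derive q t (dq t)) ->
  (forall t, 1 <= t -> 0 < w t -> 0 <= dq t) ->
  0 <= q 1 -> 1 <= r0 <= r -> 0 < w r0 -> 0 < w r.
Proof.
  intros Hw Hq Hdq Hq1 Hr Hw0.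
  set (m := fun t => Rmax 0 (w t)).
  assert (Hm0 : forall t, 0 <= m t) by (intros t; apply Rmax_l).
  assert (Hm : forall t, 1 <= t -> is_derive (fun t => m t * m t) t (2 * m t * (q t / t ^ N))).
  { intros t Ht. rewrite Rmult_comm.
    apply (is_derive_comp (fun x => Rmax 0 x * Rmax 0 x) w); [apply is_derive_sqr_pos_part|auto]. }
  assert (Hmq : forall t, 1 <= t -> is_derive (fun t => m t * m t * q t) t
     (2 * m t * (q t / t ^ N) * q t + m t * m t * dq t)).
  { intros t Ht. apply (is_derive_mult (fun t => m t * m t) q); auto. intros; apply Rmult_comm. }
  assert (Hpos : forall t, 1 <= t -> 0 <= m t * m t * q t).
  { intros t Ht. apply Rle_trans with (m 1 * m 1 * q 1).
    { specialize (Hm0 1). apply Rmult_le_pos; [nra|assumption]. }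
    eapply (nonneg_derive_le (fun t => m t * m t * q t)); [assumption| | |].
    - intros x Hx. eapply is_derive_continuous, Hmq; lra.
    - intros x Hx. apply Hmq; lra.
    - intros x Hx. simpl. apply Rplus_le_le_0_compat.
      + replace (2 * m x * (q x / x ^ N) * q x) with (2 * m x * (q x * q x) / x ^ N)
          by (unfold Rdiv; ring).
        apply Rdiv_le_0_compat; [|apply pow_lt; lra].
        apply Rmult_le_pos; [specialize (Hm0 x); lra|apply Rle_0_sqr].
      + destruct (Rle_lt_dec (w x) 0) as [Hx0|Hx0].
        * unfold m. rewrite Rmax_left by assumption. lra.
        * apply Rmult_le_pos; [apply Rle_0_sqr|apply Hdq; [lra|assumption]]. }
  assert (Hmm : m r0 * m r0 <= m r * m r).
  { eapply (nonneg_derive_le (fun t => m t * m t)); [lra| | |].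
    - intros x Hx. eapply is_derive_continuous, Hm; lra.
    - intros x Hx. apply Hm; lra.
    - intros x Hx. simpl.
      replace (2 * m x * (q x / x ^ N)) with (2 * (m x * q x) / x ^ N) by (unfold Rdiv; ring).
      apply Rdiv_le_0_compat; [|apply pow_lt; lra].
      specialize (Hpos x ltac:(lra)). specialize (Hm0 x).
      (* From [m^2 q >= 0] and [m >= 0] one gets [m q >= 0]: trivially if [m] vanishes, by dividing
         by [m] otherwise. *)
      destruct (Req_dec (m x) 0) as [->|Hne]; [lra|]. nra. }
  apply Rnot_le_lt. intros Hle.
  unfold m in Hmm. rewrite (Rmax_left 0 (w r)), Rmax_right in Hmm by lra. nra.
Qed.

(** For [psi = A exp (- sigma t)] one has [psi'' + (N / t) psi' <= sigma^2 psi <= g(psi)], so by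
    monotonicity of [g] the flux of [u - psi] is nondecreasing wherever [u > psi]. The condition on
    [p 1] says that this flux starts nonnegative, as [psi'(1) = - A sigma exp (- sigma)]. *)
Lemma above_barrier_persists (N : nat) (g u p : R -> R) (A sigma r0 r : R) :
  radial_flow N g u p -> (forall x y, x <= y -> g x <= g y) ->
  0 <= A -> 0 < sigma -> - (A * sigma * exp (- sigma)) <= p 1 ->
  (forall t, 1 <= t -> sigma * sigma * (A * exp (- sigma * t)) <= g (A * exp (- sigma * t))) ->
  1 <= r0 <= r -> A * exp (- sigma * r0) < u r0 -> A * exp (- sigma * r) < u r.
Proof.
  intros Hflow Hg HA Hs Hp1 Hsuper Hr H0.
  set (psi := fun t => A * exp (- sigma * t)).
  assert (Hpsi0 : forall t, 0 <= psi t).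
  { intros t. apply Rmult_le_pos; [assumption|left; apply exp_pos]. }
  assert (Hpsi : forall t, is_derive psi t (- sigma * A * exp (- sigma * t))).
  { intros t. apply is_derive_exp_scal. }
  cut (0 < u r - psi r); [unfold psi; lra|].
  apply (positivity_persists N (fun t => u t - psi t) (fun t => p t + sigma * (t ^ N * psi t))
    (fun t => t ^ N * g (u t) + sigma * (INR N * t ^ pred N * psi t - sigma * (t ^ N * psi t))) r0 r).
  - intros t Ht. destruct (Hflow t Ht) as [Hu _].
    replace ((p t + sigma * (t ^ N * psi t)) / t ^ N) with (p t / t ^ N - (- sigma * A * exp (- sigma * t))).
    + apply (is_derive_minus (V := R_NormedModule)); [exact Hu|apply Hpsi].
    + unfold psi. field. apply pow_nonzero. lra.
  - intros t Ht. destruct (Hflow t Ht) as [_ Hp].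
    apply (is_derive_plus (V := R_NormedModule)); [exact Hp|].
    unfold psi. auto_derive; [trivial|ring].
  - intros t Ht Hwt. specialize (Hsuper t Ht). fold (psi t) in Hsuper.
    specialize (Hg (psi t) (u t) ltac:(lra)).
    assert (0 < t ^ N) by (apply pow_lt; lra).
    assert (0 <= INR N * t ^ pred N * psi t).
    { apply Rmult_le_pos; [apply Rmult_le_pos; [apply pos_INR|apply pow_le; lra]|apply Hpsi0]. }
    assert (0 <= t ^ N * (g (u t) - sigma * sigma * psi t)) by (apply Rmult_le_pos; lra).
    nra.
  - rewrite pow1. unfold psi. rewrite Rmult_1_r. lra.
  - exact Hr.
  - unfold psi. lra.
Qed.

(** Reflection exchanges the two barriers, so exit through the bottom follows from exit through the
    top. *)
Lemma radial_flow_opp (N : nat) (g u p : R -> R) :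
  radial_flow N g u p -> radial_flow N (fun x => - g (- x)) (fun t => - u t) (fun t => - p t).
Proof.
  intros H t Ht. destruct (H t Ht) as [Hu Hp]. split.
  - replace (- p t / t ^ N) with (- (p t / t ^ N)) by (unfold Rdiv; ring).
    apply (is_derive_opp (V := R_NormedModule)). exact Hu.
  - rewrite Ropp_involutive. replace (t ^ N * - g (u t)) with (- (t ^ N * g (u t))) by ring.
    apply (is_derive_opp (V := R_NormedModule)). exact Hp.
Qed.

(* Shooting on the value [s] at the wall: the values whose flow leaves the
   strip through the top and through the bottom form disjoint open sets. *)
Lemma flow_between_barriers (N : nat) (g : R -> R) (L A sigma b : R) : 0 <= L ->
  (forall x y, Rabs (g x - g y) <= L * Rabs (x - y)) ->
  (forall x y, x <= y -> g x <= g y) ->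
  0 <= A -> 0 < sigma -> Rabs b <= A * sigma * exp (- sigma) ->
  (forall t, 1 <= t -> sigma * sigma * (A * exp (- sigma * t)) <= g (A * exp (- sigma * t))) ->
  (forall t, 1 <= t -> g (- (A * exp (- sigma * t))) <= - (sigma * sigma * (A * exp (- sigma * t)))) ->
  exists u p, radial_flow N g u p /\ p 1 = b /\
    forall t, 1 <= t -> Rabs (u t) <= A * exp (- sigma * t).
Proof.
  intros HL HLip Hmon HA Hs Hb Hsup Hsub.
  set (psi := fun t => A * exp (- sigma * t)).
  assert (Hpsi0 : forall t, 0 <= psi t).
  { intros t. apply Rmult_le_pos; [assumption|left; apply exp_pos]. }
  apply Rabs_le_between in Hb.
  assert (Hex : forall s, exists up : (R -> R) * (R -> R),
    radial_flow N g (fst up) (snd up) /\ fst up 1 = s /\ snd up 1 = b).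
  { intros s. destruct (radial_ivp N g L s b HL HLip) as [u [p [Hu [Hp Hf]]]].
    exists (u, p). simpl. auto. }
  destruct (functional_choice _ Hex) as [F HF].
  set (U := fun s => fst (F s)).
  assert (Hdep : forall s s' t, 1 <= t -> Rabs (U s t - U s' t) <= Rabs (s - s') * exp ((1 + L) * (t - 1))).
  { intros s s' t Ht. destruct (HF s) as [F1 [U1 P1]]. destruct (HF s') as [F2 [U2 P2]].
    rewrite <- U1, <- U2 at 2.
    apply (radial_flow_dependence N g L _ (snd (F s)) _ (snd (F s'))); try assumption. congruence. }
  assert (Hup : forall s r0 r, 1 <= r0 <= r -> psi r0 < U s r0 -> psi r < U s r).
  { intros s r0 r Hr H0. destruct (HF s) as [F1 [U1 P1]].
    apply (above_barrier_persists N g (U s) (snd (F s)) A sigma r0 r); try assumption. lra. }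
  assert (Hdn : forall s r0 r, 1 <= r0 <= r -> U s r0 < - psi r0 -> U s r < - psi r).
  { intros s r0 r Hr H0. destruct (HF s) as [F1 [U1 P1]].
    cut (psi r < - U s r); [lra|].
    apply (above_barrier_persists N (fun x => - g (- x)) (fun t => - U s t) (fun t => - snd (F s) t) A sigma r0 r);
      try assumption.
    - apply radial_flow_opp. exact F1.
    - intros x y Hxy. specialize (Hmon (- y) (- x) ltac:(lra)). lra.
    - lra.
    - intros t Ht. specialize (Hsub t Ht). lra.
    - fold (psi r0). lra. }
  set (Up := fun s => exists r, 1 <= r /\ psi r < U s r).
  set (Dn := fun s => exists r, 1 <= r /\ U s r < - psi r).
  (* Both exits persist, so at the later of the two exit times the flow would be above the upper and
     below the lower barrier. *)
  assert (Hdisj : forall s, Up s -> Dn s -> False).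
  { intros s [r1 [Hr1 H1]] [r2 [Hr2 H2]].
    pose proof (Hpsi0 (Rmax r1 r2)).
    pose proof (Hup s r1 (Rmax r1 r2) (conj Hr1 (Rmax_l _ _)) H1).
    pose proof (Hdn s r2 (Rmax r1 r2) (conj Hr2 (Rmax_r _ _)) H2). lra. }
  assert (Hnear : forall s t gap, 1 <= t -> 0 < gap ->
    exists d, 0 < d /\ forall s', Rabs (s' - s) < d -> Rabs (U s' t - U s t) < gap).
  { intros s t gap Ht Hgap. pose proof (exp_pos ((1 + L) * (t - 1))) as He.
    exists (gap / exp ((1 + L) * (t - 1))). split; [apply Rdiv_lt_0_compat; assumption|].
    intros s' Hs'. apply Rle_lt_trans with (1 := Hdep s' s t Ht).
    apply (Rmult_lt_compat_r _ _ _ He) in Hs'. unfold Rdiv in Hs'.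
    rewrite Rmult_assoc, Rinv_l, Rmult_1_r in Hs' by lra. exact Hs'. }
  assert (HU1 : forall s, U s 1 = s) by (intros s; apply (HF s)).
  (* The supremum of [Dn] is the shooting value. Openness of [Dn] keeps it out of [Dn]; were it in
     [Up], a whole left neighbourhood would avoid [Dn] and give a smaller upper bound. *)
  destruct (completeness Dn) as [s [Hub Hlub]].
  { exists (psi 1). intros s Hsd. apply Rnot_lt_le. intros Hlt. apply (Hdisj s); [|exact Hsd].
    exists 1. rewrite HU1. split; lra. }
  { exists (- psi 1 - 1). exists 1. rewrite HU1. lra. }
  assert (HnDn : ~ Dn s).
  { intros [r [Hr H]]. destruct (Hnear s r (- psi r - U s r) Hr ltac:(lra)) as [d [Hd Hd']].
    specialize (Hd' (s + d / 2)). replace (s + d / 2 - s) with (d / 2) in Hd' by ring.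
    rewrite (Rabs_pos_eq (d / 2)) in Hd' by lra. specialize (Hd' ltac:(lra)).
    assert (Dn (s + d / 2)) as HD.
    { exists r. split; [assumption|]. apply Rabs_def2 in Hd'. lra. }
    apply Hub in HD. lra. }
  assert (HnUp : ~ Up s).
  { intros [r [Hr H]]. destruct (Hnear s r (U s r - psi r) Hr ltac:(lra)) as [d [Hd Hd']].
    assert (is_upper_bound Dn (s - d)) as HB.
    { intros s' Hs'. apply Rnot_lt_le. intros Hlt. pose proof (Hub s' Hs').
      apply (Hdisj s'); [|exact Hs']. exists r. split; [assumption|].
      specialize (Hd' s' ltac:(apply Rabs_def1; lra)). apply Rabs_def2 in Hd'. lra. }
    apply Hlub in HB. lra. }
  exists (U s), (snd (F s)). destruct (HF s) as [F1 [U1 P1]]. split; [exact F1|]. split; [exact P1|].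
  intros t Ht. fold (psi t). apply Rabs_le_between. split; apply Rnot_lt_le; intros Hlt.
  - apply HnDn. exists t. auto.
  - apply HnUp. exists t. auto.
Qed.

(** * First integral and uniqueness *)

Lemma is_derive_Rpower (a x : R) : 0 < x -> is_derive (fun x => Rpower x a) x (a * Rpower x (a - 1)).
Proof. intros Hx. apply is_derive_Reals, derivable_pt_lim_power, Hx. Qed.

(** The logarithm and the power share the formula [h' = gamma rho^(gamma - 2)]. Beyond this lemma
    the case distinction on [gamma] never reappears. *)
Lemma is_derive_enthalpy (gamma x : R) : 0 < x ->
  is_derive (enthalpy gamma) x (gamma * Rpower x (gamma - 2)).
Proof.
  intros Hx. unfold enthalpy. destruct (Req_EM_T gamma 1) as [->|Hg].
  - replace (1 * Rpower x (1 - 2)) with (/ x).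
    + apply is_derive_Reals, derivable_pt_lim_ln, Hx.
    + replace (1 - 2) with (- (1)) by ring. rewrite Rpower_Ropp, Rpower_1 by exact Hx. ring.
  - replace (gamma * Rpower x (gamma - 2)) with (gamma / (gamma - 1) * ((gamma - 1) * Rpower x (gamma - 1 - 1))).
    + apply (is_derive_scal (fun x => Rpower x (gamma - 1))), is_derive_Rpower, Hx.
    + replace (gamma - 1 - 1) with (gamma - 2) by ring. field. lra.
Qed.

(** The derivative is written as [x] times that of the enthalpy, that is, as [P' = rho h'], which is
    the form that makes the equation integrable. *)
Lemma is_derive_pressure (gamma x : R) : 0 < x ->
  is_derive (pressure gamma) x (x * (gamma * Rpower x (gamma - 2))).
Proof.
  intros Hx. replace (x * (gamma * Rpower x (gamma - 2))) with (gamma * Rpower x (gamma - 1)).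
  - apply is_derive_Rpower, Hx.
  - replace (gamma - 1) with ((gamma - 2) + 1) at 1 by ring. rewrite Rpower_plus, Rpower_1 by exact Hx. ring.
Qed.

Lemma Rpower_pos (x a : R) : 0 < Rpower x a.
Proof. apply exp_pos. Qed.

Lemma enthalpy_le (gamma x y : R) : 1 <= gamma -> 0 < x <= y -> enthalpy gamma x <= enthalpy gamma y.
Proof.
  intros Hg Hxy.
  apply nonneg_derive_le with (fun x => gamma * Rpower x (gamma - 2)); [lra| | |].
  - intros z Hz. eapply is_derive_continuous, is_derive_enthalpy; lra.
  - intros z Hz. apply is_derive_enthalpy; lra.
  - intros z Hz. pose proof (Rpower_pos z (gamma - 2)). nra.
Qed.

(** * Relative derivatives and functions smooth up to the wall *)

Lemma D_in_is_derive (f d : R -> R) (D : R -> Prop) (x : R) :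
  locally x D -> D_in f d D x -> is_derive f x (d x).
Proof.
  intros [r Hr] H. apply is_derive_Reals. intros eps He.
  destruct (H eps He) as [alp [Ha HD]].
  assert (Hm : 0 < Rmin r alp) by (apply Rmin_pos; [apply cond_pos|exact Ha]).
  exists (mkposreal _ Hm). simpl. intros h Hh Hhm.
  specialize (HD (x + h)). simpl in HD. unfold Rdist in HD.
  replace (x + h - x) with h in HD by ring. apply HD. split; [split|].
  - apply Hr. unfold ball; simpl. unfold AbsRing_ball, abs, minus, plus, opp; simpl.
    replace (x + h + - x) with h by ring. apply Rlt_le_trans with (1 := Hhm), Rmin_l.
  - lra.
  - apply Rlt_le_trans with (1 := Hhm), Rmin_r.
Qed.

Lemma is_derive_D_in (f : R -> R) (l : R) (D : R -> Prop) (x : R) :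
  is_derive f x l -> D_in f (fun _ => l) D x.
Proof.
  intros H eps He. apply is_derive_Reals in H. destruct (H eps He) as [alp Ha].
  exists alp. split; [apply cond_pos|]. intros y [[_ Hne] Hy]. simpl in *. unfold Rdist in *.
  specialize (Ha (y - x) ltac:(lra) Hy). replace (x + (y - x)) with y in Ha by ring. exact Ha.
Qed.

Lemma locally_exterior (t : R) : 1 < t -> locally t exterior.
Proof.
  intros Ht. generalize (open_gt 1 t Ht). apply filter_imp. intros x Hx. unfold exterior. lra.
Qed.

(** Trades one-sided derivatives at the wall for functions continuous on [R] and differentiable for
    [t > 1], exactly what the monotonicity lemma consumes. The wall slope is identified by
    uniqueness of limits along the exterior. *)
Lemma smooth_on_exterior_extend (f : R -> R) : smooth_on exterior f ->
  exists e : nat -> R -> R,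
    (forall k t, continuous (e k) t) /\ (forall t, 1 <= t -> e O t = f t) /\
    (forall k t, 1 < t -> is_derive (e k) t (e (S k) t)) /\
    (forall b, D_in f (fun _ => b) exterior 1 -> e 1%nat 1 = b).
Proof.
  intros [d [Hd0 Hd]]. exists (fun k t => d k (Rmax 1 t)). split; [|split; [|split]].
  - intros k t. apply continuous_eps. intros eps He.
    pose proof (cont_deriv _ _ _ _ (Hd k (Rmax 1 t) (Rmax_l 1 t))) as Hc.
    destruct (Hc eps He) as [alp [Ha H]].
    pose proof (continuous_Rmax_l 1 t) as Hm. rewrite continuous_eps in Hm.
    destruct (Hm alp Ha) as [r [Hr Hm']]. exists r. split; [exact Hr|].
    intros y Hy. specialize (Hm' y Hy).
    (* The relative limit excludes the base point itself, so coincidence of the two retracted points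
       is a separate case. *)
    destruct (Req_dec (Rmax 1 t) (Rmax 1 y)) as [E|E].
    + rewrite E, Rminus_diag, Rabs_R0. exact He.
    + apply (H (Rmax 1 y)). split; [split; [apply Rmax_l|exact E]|exact Hm'].
  - intros t Ht. rewrite Rmax_right by assumption. apply Hd0. exact Ht.
  - intros k t Ht. rewrite (Rmax_right 1 t) by lra.
    apply is_derive_ext_loc with (d k).
    + generalize (locally_exterior t Ht). apply filter_imp.
      intros x Hx. rewrite Rmax_right by exact Hx. reflexivity.
    + apply D_in_is_derive with exterior; [apply locally_exterior, Ht|].
      apply Hd. unfold exterior. lra.
  - intros b Hb. rewrite Rmax_right by lra. symmetry.
    apply (single_limit (fun x => (f x - f 1) / (x - 1)) (D_x exterior 1) b (d 1%nat 1) 1); [|exact Hb|].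
    + intros alp Ha. exists (1 + alp / 2). split; [split; unfold exterior; lra|].
      simpl. unfold Rdist. apply Rabs_def1; lra.
    + intros eps He. destruct (Hd O 1 (Rle_refl 1) eps He) as [alp [Ha H]].
      exists alp. split; [exact Ha|]. intros x Hx. specialize (H x Hx).
      rewrite <- (Hd0 x), <- (Hd0 1); [exact H|apply Rle_refl|apply Hx].
Qed.

(** Integrating [(t^N u')' >= eps t^N] gives [t^N u' >= c t^(N+1) - K], hence [u' >= c t - K], and a
    second integration gives quadratic growth. The constant [c = eps / (N + 1)] comes from the
    primitive of [eps t^N]. *)
Lemma bounded_laplacian_absurd (N : nat) (u u1 u2 : R -> R) (a eps B : R) :
  1 <= a -> 0 < eps ->
  (forall t, a <= t -> is_derive u t (u1 t)) ->
  (forall t, a <= t -> is_derive u1 t (u2 t)) ->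
  (forall t, a <= t -> eps <= u2 t + INR N / t * u1 t) ->
  (forall t, a <= t -> Rabs (u t) <= B) -> False.
Proof.
  intros Ha He Hu Hu1 Hlap HB.
  set (c := eps / INR (S N)).
  assert (HN : 0 < INR (S N)) by (apply lt_0_INR; lia).
  assert (Hc : 0 < c) by (apply Rdiv_lt_0_compat; assumption).
  set (y := fun t => t ^ N * u1 t - c * t ^ S N).
  set (dy := fun t => t ^ N * (u2 t + INR N / t * u1 t - eps)).
  assert (Hy : forall t, a <= t -> is_derive y t (dy t)).
  { intros t Ht. specialize (Hu1 t Ht). unfold y. auto_derive.
    - repeat split; trivial. exists (u2 t). exact Hu1.
    - rewrite (Derive_eq _ _ _ Hu1). unfold dy.
      replace eps with (c * INR (S N)) by (unfold c; field; lra).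
      rewrite S_INR. destruct N as [|N].
      + simpl. match goal with |- @eq _ ?l ?r => change (@eq R l r) end. field. lra.
      + simpl pred. change (t ^ S (S N)) with (t * (t * t ^ N)). change (t ^ S N) with (t * t ^ N).
        match goal with |- @eq _ ?l ?r => change (@eq R l r) end. field. lra. }
  assert (Hyle : forall t, a <= t -> y a <= y t).
  { intros t Ht. apply nonneg_derive_le with dy; [assumption| | |].
    - intros x Hx. eapply is_derive_continuous, Hy; lra.
    - intros x Hx. apply Hy; lra.
    - intros x Hx. apply Rmult_le_pos; [apply pow_le; lra|]. specialize (Hlap x ltac:(lra)). lra. }
  set (K := Rabs (y a)).
  assert (HK : 0 <= K) by apply Rabs_pos.
  assert (Hu1le : forall t, a <= t -> 0 <= u1 t - c * t + K).
  { intros t Ht. specialize (Hyle t Ht).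
    assert (Hp : 1 <= t ^ N) by (apply pow_R1_Rle; lra).
    assert (- K <= t ^ N * (u1 t - c * t)).
    { replace (t ^ N * (u1 t - c * t)) with (y t) by (unfold y; simpl; ring).
      pose proof (Rle_abs (- y a)) as X. rewrite Rabs_Ropp in X. fold K in X. lra. }
    destruct (Rle_lt_dec 0 (u1 t - c * t)); [lra|]. nra. }
  assert (Hz : forall t, a <= t -> u a - c / 2 * (a * a) + K * a <= u t - c / 2 * (t * t) + K * t).
  { intros t Ht.
    apply (nonneg_derive_le (fun t => u t - c / 2 * (t * t) + K * t) (fun t => u1 t - c * t + K)); [assumption| | |].
    2: intros x Hx; specialize (Hu x ltac:(lra)); auto_derive;
       [repeat split; trivial; exists (u1 x); exact Hu|rewrite (Derive_eq _ _ _ Hu); field].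
    - intros x Hx. specialize (Hu x ltac:(lra)).
      apply (ex_derive_continuous (fun t => u t - c / 2 * (t * t) + K * t)). auto_derive.
      repeat split; trivial. exists (u1 x). exact Hu.
    - intros x Hx. apply Hu1le; lra. }
  set (M := 2 * B + c / 2 * (a * a)).
  (* Far enough that [c t >= 2 (K + M + 1)]: then [c t^2 / 2] exceeds [M + K t], as [t >= 1]. *)
  set (t := a + 2 * (K + M + 1) / c).
  assert (HB0 : 0 <= B) by (apply Rle_trans with (2 := HB a (Rle_refl a)), Rabs_pos).
  assert (HM : 0 <= M) by (unfold M; nra).
  assert (Hta : a <= t).
  { unfold t. assert (0 <= 2 * (K + M + 1) / c) by (apply Rdiv_le_0_compat; lra). lra. }
  assert (Hct : 2 * (K + M + 1) <= c * t).
  { unfold t. replace (c * (a + 2 * (K + M + 1) / c)) with (c * a + 2 * (K + M + 1)) by (field; lra). nra. }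
  specialize (Hz t Hta). pose proof (HB t Hta) as Bt. pose proof (HB a (Rle_refl a)) as Ba.
  apply Rabs_le_between in Bt, Ba.
  assert (c / 2 * (t * t) <= M + K * t) by (unfold M; nra).
  nra.
Qed.

Lemma is_lim_p_infty_eps (f : R -> R) (l eps : R) : is_lim f p_infty l -> 0 < eps ->
  exists M, forall t, M < t -> Rabs (f t - l) < eps.
Proof.
  intros H He. apply is_lim_spec in H. exact (H (mkposreal eps He)).
Qed.

(* If the constant of integration were not [- h(rho_plus)], the Laplacian of the
   bounded function [rho] would stay away from 0. *)
Lemma stationary_first_integral (N : nat) (gamma kappa rho_plus b : R) (rho : R -> R)
    (e : nat -> R -> R) :
  0 < kappa -> 0 < rho_plus ->
  stationary_solution (S N) gamma kappa rho_plus b rho ->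
  (forall t, 1 <= t -> e O t = rho t) ->
  (forall k t, 1 < t -> is_derive (e k) t (e (S k) t)) ->
  forall t, 1 < t ->
    kappa * (e 2%nat t + INR N / t * e 1%nat t) = enthalpy gamma (rho t) - enthalpy gamma rho_plus.
Proof.
  intros Hk Hrp [_ [Hpos [Heq [_ Hlim]]]] He0 He.
  assert (Hloc : forall t (P : R -> Prop), 1 < t -> (forall x, 1 < x -> P x) -> locally t P).
  { intros t P Ht HP. generalize (open_gt 1 t Ht). apply filter_imp. exact HP. }
  assert (Hrho : forall t, 1 < t -> is_derive rho t (e 1%nat t)).
  { intros t Ht. apply is_derive_ext_loc with (e O); [|apply He, Ht].
    apply Hloc; [assumption|]. intros x Hx. apply He0. lra. }
  assert (HD1 : forall t, 1 < t -> Derive rho t = e 1%nat t).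
  { intros t Ht. apply is_derive_unique, Hrho, Ht. }
  assert (Hlap : forall t, 1 < t -> radial_laplacian (S N) rho t = e 2%nat t + INR N / t * e 1%nat t).
  { intros t Ht. unfold radial_laplacian. rewrite HD1, S_INR by exact Ht.
    replace (INR N + 1 - 1) with (INR N) by ring. f_equal.
    change (Derive_n rho 2 t) with (Derive (Derive rho) t).
    rewrite (Derive_ext_loc _ (e 1%nat)).
    - apply is_derive_unique, He, Ht.
    - apply Hloc; assumption. }
  set (Lap := fun t => e 2%nat t + INR N / t * e 1%nat t).
  assert (HexLap : forall t, 1 < t -> ex_derive Lap t).
  { intros t Ht. unfold Lap. auto_derive.
    repeat split; try lra; [exists (e 3%nat t)|exists (e 2%nat t)]; apply He, Ht. }
  (* Since [P' = rho h'], the equation is [rho] times [Q' = 0], and [rho] is positive. *)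
  set (Q := fun t => kappa * Lap t - enthalpy gamma (rho t)).
  assert (HQ : forall t, 1 < t -> is_derive Q t 0).
  { intros t Ht. specialize (Heq t Ht). specialize (Hpos t ltac:(lra)).
    rewrite (Derive_ext_loc (radial_laplacian (S N) rho) Lap) in Heq by (apply Hloc; assumption).
    assert (EP : Derive (fun s : R => pressure gamma (rho s)) t =
      e 1%nat t * (rho t * (gamma * Rpower (rho t) (gamma - 2)))).
    { apply is_derive_unique, (is_derive_comp (pressure gamma) rho); [apply is_derive_pressure, Hpos|apply Hrho, Ht]. }
    rewrite EP in Heq.
    assert (E : kappa * Derive Lap t = e 1%nat t * (gamma * Rpower (rho t) (gamma - 2))).
    { apply (Rmult_eq_reg_l (rho t)); [|lra]. lra. }
    replace 0 with (kappa * Derive Lap t - e 1%nat t * (gamma * Rpower (rho t) (gamma - 2))) by lra.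
    apply (is_derive_minus (V := R_NormedModule) (fun t => kappa * Lap t)).
    - apply is_derive_scal, Derive_correct, HexLap, Ht.
    - apply (is_derive_comp (enthalpy gamma) rho); [apply is_derive_enthalpy, Hpos|apply Hrho, Ht]. }
  assert (HQc : forall s t, 1 < s <= t -> Q s = Q t).
  { intros s t Hst.
    pose proof (derive_bound Q (fun _ => 0) (fun _ => 0) (fun _ => 0) s t ltac:(lra)) as D.
    assert (Rabs (Q t - Q s) <= 0 - 0) as D'.
    { apply D.
      - intros x Hx. apply HQ. lra.
      - intros x Hx. apply (is_derive_const (V := R_NormedModule)).
      - intros x Hx. rewrite Rabs_R0. lra. }
    apply Rabs_le_between in D'. lra. }
  set (l := Q 2 + enthalpy gamma rho_plus).
  assert (Hl : forall t, 1 < t -> kappa * Lap t = enthalpy gamma (rho t) - enthalpy gamma rho_plus + l).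
  { intros t Ht. unfold l.
    assert (Q t = Q 2) as E by (destruct (Rle_lt_dec t 2); [|symmetry]; apply HQc; lra).
    rewrite <- E. unfold Q. ring. }
  assert (Hl0 : l = 0).
  { destruct (Req_dec l 0) as [|Hl0]; [assumption|exfalso].
    assert (Hal : 0 < Rabs l / 2) by (pose proof (Rabs_pos_lt l Hl0); lra).
    assert (Hc : continuous (enthalpy gamma) rho_plus).
    { eapply is_derive_continuous, is_derive_enthalpy, Hrp. }
    rewrite continuous_eps in Hc. destruct (Hc _ Hal) as [d [Hd Hh]].
    destruct (is_lim_p_infty_eps rho rho_plus d Hlim Hd) as [M HM].
    set (a := Rmax 2 (M + 1)).
    assert (Ha2 : 2 <= a) by apply Rmax_l. assert (HaM : M + 1 <= a) by apply Rmax_r.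
    assert (HB : forall t, a <= t -> Rabs (e O t) <= rho_plus + d).
    { intros t Ht. rewrite He0 by lra. specialize (HM t ltac:(lra)).
      apply Rabs_def2 in HM. apply Rabs_le_between. lra. }
    assert (Hclose : forall t, a <= t -> Rabs (kappa * Lap t - l) < Rabs l / 2).
    { intros t Ht. rewrite Hl by lra. replace (enthalpy gamma (rho t) - enthalpy gamma rho_plus + l - l)
        with (enthalpy gamma (rho t) - enthalpy gamma rho_plus) by ring.
      apply Hh, HM. lra. }
    assert (Heps : 0 < Rabs l / 2 / kappa) by (apply Rdiv_lt_0_compat; assumption).
    destruct (Rle_lt_dec 0 l) as [Hs|Hs].
    - apply (bounded_laplacian_absurd N (e O) (e 1%nat) (e 2%nat) a (Rabs l / 2 / kappa) (rho_plus + d));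
        try assumption; try lra.
      + intros t Ht. apply He. lra.
      + intros t Ht. apply He. lra.
      + intros t Ht. specialize (Hclose t Ht). rewrite (Rabs_pos_eq l) in * by lra. apply Rabs_def2 in Hclose.
        fold (Lap t). apply (Rmult_le_reg_l kappa); [assumption|].
        replace (kappa * (l / 2 / kappa)) with (l / 2) by (field; lra). lra.
    (* A negative constant is handled by reflecting the function. *)
    - apply (bounded_laplacian_absurd N (fun t => - e O t) (fun t => - e 1%nat t) (fun t => - e 2%nat t) a (Rabs l / 2 / kappa) (rho_plus + d));
        try assumption; try lra.
      + intros t Ht. apply (is_derive_opp (V := R_NormedModule)), He. lra.
      + intros t Ht. apply (is_derive_opp (V := R_NormedModule)), He. lra.
      + intros t Ht. specialize (Hclose t Ht). rewrite (Rabs_left l) in * by lra. apply Rabs_def2 in Hclose.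
        replace (- e 2%nat t + INR N / t * - e 1%nat t) with (- Lap t) by (unfold Lap; ring).
        apply (Rmult_le_reg_l kappa); [assumption|].
        replace (kappa * (- l / 2 / kappa)) with (- l / 2) by (field; lra). lra.
      + intros t Ht. rewrite Rabs_Ropp. auto. }
  intros t Ht. fold (Lap t). rewrite Hl, Hl0 by exact Ht. ring.
Qed.

(* Energy argument: for the difference [w] of two solutions,
   [r^(n-1) w w'] vanishes at the wall and is nondecreasing, hence so is [w^2]. *)
Lemma stationary_solution_unique (N : nat) (gamma kappa rho_plus b : R) (f g : R -> R) :
  1 <= gamma -> 0 < kappa -> 0 < rho_plus ->
  stationary_solution (S N) gamma kappa rho_plus b f ->
  stationary_solution (S N) gamma kappa rho_plus b g ->
  forall r, 1 <= r -> f r = g r.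
Proof.
  intros Hg Hk Hrp Sf Sg.
  destruct (smooth_on_exterior_extend f (proj1 Sf)) as [e [Ec [E0 [Ed Eb]]]].
  destruct (smooth_on_exterior_extend g (proj1 Sg)) as [e' [Ec' [E0' [Ed' Eb']]]].
  pose proof (stationary_first_integral N gamma kappa rho_plus b f e Hk Hrp Sf E0 Ed) as If.
  pose proof (stationary_first_integral N gamma kappa rho_plus b g e' Hk Hrp Sg E0' Ed') as Ig.
  destruct Sf as [_ [Pf [_ [Bf Lf]]]]. destruct Sg as [_ [Pg [_ [Bg Lg]]]].
  set (w := fun t => e O t - e' O t). set (z := fun t => e 1%nat t - e' 1%nat t).
  set (dz := fun t => e 2%nat t - e' 2%nat t).
  assert (Hwc : forall t, continuous w t).
  { intros t. apply (continuous_minus (V := R_NormedModule)); auto. }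
  assert (Hzc : forall t, continuous z t).
  { intros t. apply (continuous_minus (V := R_NormedModule)); auto. }
  assert (Hw : forall t, 1 < t -> is_derive w t (z t)).
  { intros t Ht. apply (is_derive_minus (V := R_NormedModule)); auto. }
  assert (Hz : forall t, 1 < t -> is_derive z t (dz t)).
  { intros t Ht. apply (is_derive_minus (V := R_NormedModule)); auto. }
  assert (Hz1 : z 1 = 0) by (unfold z; rewrite (Eb b Bf), (Eb' b Bg); ring).
  assert (Hpc : forall t, continuous (fun t : R => t ^ N) t).
  { intros t. apply (ex_derive_continuous (fun x => x ^ N)). auto_derive. trivial. }
  assert (Hq : forall t, 1 <= t -> 0 <= w t * z t).
  { intros t Ht.
    assert (Hle : 1 ^ N * (w 1 * z 1) <= t ^ N * (w t * z t)).
    { apply (nonneg_derive_le (fun t => t ^ N * (w t * z t))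
        (fun t => t ^ N * (z t * z t + w t * (dz t + INR N / t * z t)))); [assumption| | |].
      - intros x _. apply (continuous_mult (K := R_AbsRing) (fun t => t ^ N)); [apply Hpc|].
        apply (continuous_mult (K := R_AbsRing)); auto.
      - intros x Hx. pose proof (Hw x ltac:(lra)) as A1. pose proof (Hz x ltac:(lra)) as A2.
        auto_derive.
        + repeat split; trivial; [exists (z x)|exists (dz x)]; assumption.
        + rewrite (Derive_eq _ _ _ A1), (Derive_eq _ _ _ A2).
          destruct N as [|N']; [simpl; field; lra|]. simpl pred. change (x ^ S N') with (x * x ^ N'). field. lra.
      - intros x Hx. apply Rmult_le_pos; [apply pow_le; lra|].
        apply Rplus_le_le_0_compat; [apply Rle_0_sqr|].
        specialize (If x ltac:(lra)). specialize (Ig x ltac:(lra)).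
        assert (E : kappa * (dz x + INR N / x * z x) = enthalpy gamma (f x) - enthalpy gamma (g x)).
        { unfold dz, z. lra. }
        apply (Rmult_le_reg_l kappa); [assumption|].
        replace (kappa * (w x * (dz x + INR N / x * z x))) with (w x * (kappa * (dz x + INR N / x * z x))) by ring.
        rewrite E, Rmult_0_r. unfold w. rewrite E0, E0' by lra.
        pose proof (Pf x ltac:(lra)). pose proof (Pg x ltac:(lra)).
        destruct (Rle_lt_dec (f x) (g x)) as [Hfg|Hfg].
        + pose proof (enthalpy_le gamma (f x) (g x) Hg ltac:(lra)). nra.
        + pose proof (enthalpy_le gamma (g x) (f x) Hg ltac:(lra)). nra. }
    rewrite Hz1, !Rmult_0_r in Hle.
    assert (0 < t ^ N) by (apply pow_lt; lra). nra. }
  assert (Hmono : forall s t, 1 <= s <= t -> w s * w s <= w t * w t).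
  { intros s t Hst. apply (nonneg_derive_le (fun t => w t * w t) (fun t => 2 * (w t * z t))); [lra| | |].
    - intros x _. apply (continuous_mult (K := R_AbsRing)); auto.
    - intros x Hx. pose proof (Hw x ltac:(lra)) as A1. auto_derive.
      + repeat split; trivial; exists (z x); assumption.
      + rewrite (Derive_eq _ _ _ A1). ring.
    - intros x Hx. specialize (Hq x ltac:(lra)). lra. }
  intros r Hr. apply Rminus_diag_uniq. rewrite <- (E0 r Hr), <- (E0' r Hr). fold (w r).
  (* [w^2] is nondecreasing while [w] tends to 0, since both solutions have the limit [rho_plus]; a
     nonzero value is contradicted at a distant point. *)
  destruct (Req_dec (w r) 0) as [|Hne]; [assumption|exfalso].
  pose proof (Rabs_pos_lt _ Hne) as Hp.
  destruct (is_lim_p_infty_eps f rho_plus (Rabs (w r) / 2) Lf ltac:(lra)) as [M HM].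
  destruct (is_lim_p_infty_eps g rho_plus (Rabs (w r) / 2) Lg ltac:(lra)) as [M' HM'].
  set (t := Rmax r (Rmax M M') + 1).
  assert (Ht1 : r <= Rmax r (Rmax M M')) by apply Rmax_l.
  assert (Ht2 : Rmax M M' <= Rmax r (Rmax M M')) by apply Rmax_r.
  pose proof (Rmax_l M M'). pose proof (Rmax_r M M').
  specialize (HM t ltac:(unfold t; lra)). specialize (HM' t ltac:(unfold t; lra)).
  specialize (Hmono r t ltac:(unfold t; lra)).
  assert (Hlt : Rabs (w t) < Rabs (w r)).
  { unfold w at 1. rewrite E0, E0' by (unfold t; lra).
    apply Rabs_def2 in HM, HM'. apply Rabs_def1; lra. }
  apply Rsqr_lt_abs_1 in Hlt. unfold Rsqr in Hlt. lra.
Qed.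

(** * Existence and smoothness *)

(** Syntax of polynomials in countably many unknowns. Along a polynomial system differentiation acts
    on this syntax as a derivation, so the whole sequence of derivatives is obtained by
    iteration. *)
Inductive poly_expr : Type :=
| Cst (c : R)
| Var (i : nat)
| Add (a b : poly_expr)
| Mul (a b : poly_expr).

Fixpoint poly_eval (v : nat -> R) (a : poly_expr) : R :=
  match a with
  | Cst c => c
  | Var i => v i
  | Add a b => poly_eval v a + poly_eval v b
  | Mul a b => poly_eval v a * poly_eval v b
  end.

Fixpoint poly_derive (d : nat -> poly_expr) (a : poly_expr) : poly_expr :=
  match a with
  | Cst _ => Cst 0
  | Var i => d i
  | Add a b => Add (poly_derive d a) (poly_derive d b)
  | Mul a b => Add (Mul (poly_derive d a) b) (Mul a (poly_derive d b))
  end.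

(* All derivatives are again polynomials in the unknowns [f j]. *)
Lemma smooth_on_polynomial_system (D : R -> Prop) (f : nat -> R -> R) (d : nat -> poly_expr) (i : nat) :
  (forall j x, D x -> is_derive (f j) x (poly_eval (fun k => f k x) (d j))) ->
  smooth_on D (f i).
Proof.
  intros Hf. exists (fun k x => poly_eval (fun j => f j x) (Nat.iter k (poly_derive d) (Var i))).
  split; [reflexivity|]. intros k x Hx. simpl Nat.iter.
  generalize (Nat.iter k (poly_derive d) (Var i)) as a. intros a.
  apply is_derive_D_in.
  induction a as [c|j|a IHa b IHb|a IHa b IHb]; simpl.
  - apply (is_derive_const (V := R_NormedModule)).
  - apply Hf, Hx.
  - apply (is_derive_plus (V := R_NormedModule)); assumption.
  - apply (is_derive_mult (fun x => poly_eval (fun j => f j x) a) (fun x => poly_eval (fun j => f j x) b));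
      [assumption|assumption|intros; apply Rmult_comm].
Qed.

Lemma decaying_flow_stationary (N : nat) (gamma kappa rho_plus : R) (rho v : R -> R) :
  0 < kappa ->
  (forall t, 1 <= t -> 0 < rho t) ->
  (forall t, 1 <= t -> is_derive rho t (v t)) ->
  (forall t, 1 <= t -> is_derive v t
     ((enthalpy gamma (rho t) - enthalpy gamma rho_plus) / kappa - INR N / t * v t)) ->
  is_lim rho p_infty rho_plus ->
  stationary_solution (S N) gamma kappa rho_plus (v 1) rho.
Proof.
  intros Hk Hpos Hrho Hv Hlim.
  assert (Hloc : forall t (P : R -> Prop), 1 < t -> (forall x, 1 < x -> P x) -> locally t P).
  { intros t P Ht HP. generalize (open_gt 1 t Ht). apply filter_imp. exact HP. }
  assert (Hh : forall t, 1 <= t -> is_derive (fun t => enthalpy gamma (rho t)) t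
     (v t * (gamma * Rpower (rho t) (gamma - 2)))).
  { intros t Ht. apply (is_derive_comp (enthalpy gamma) rho); [apply is_derive_enthalpy|]; auto. }
  split; [|split; [|split; [|split]]].
  (* These functions close up under differentiation: [1 / t] serves the damping term,
     [rho^(gamma - 2)] the derivative of h, and [1 / rho] the derivative of that power. *)
  - set (f := fun i : nat => match i with
      | 0%nat => rho | 1%nat => v | 2%nat => fun t => / t | 3%nat => fun t => / rho t
      | 4%nat => fun t => enthalpy gamma (rho t) | 5%nat => fun t => Rpower (rho t) (gamma - 2)
      | _ => fun _ => 0 end).
    set (d := fun i : nat => match i with
      | 0%nat => Var 1
      | 1%nat => Add (Mul (Cst (/ kappa)) (Add (Var 4) (Cst (- enthalpy gamma rho_plus))))
                     (Mul (Cst (- INR N)) (Mul (Var 2) (Var 1)))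
      | 2%nat => Mul (Cst (-1)) (Mul (Var 2) (Var 2))
      | 3%nat => Mul (Cst (-1)) (Mul (Var 1) (Mul (Var 3) (Var 3)))
      | 4%nat => Mul (Var 1) (Mul (Cst gamma) (Var 5))
      | 5%nat => Mul (Var 1) (Mul (Cst (gamma - 2)) (Mul (Var 5) (Var 3)))
      | _ => Cst 0 end).
    apply (smooth_on_polynomial_system exterior f d 0%nat).
    intros j t Ht. unfold exterior in Ht. pose proof (Hpos t Ht) as Hp.
    destruct j as [|[|[|[|[|[|j]]]]]]; simpl.
    + auto.
    + replace (/ kappa * (enthalpy gamma (rho t) + - enthalpy gamma rho_plus) + - INR N * (/ t * v t))
        with ((enthalpy gamma (rho t) - enthalpy gamma rho_plus) / kappa - INR N / t * v t)
        by (field; split; lra).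
      auto.
    + auto_derive; [lra|]. match goal with |- @eq _ ?l ?r => change (@eq R l r) end. field. lra.
    + pose proof (Hrho t Ht) as Hr. auto_derive.
      * split; [exists (v t); exact Hr|lra].
      * rewrite (Derive_eq _ _ _ Hr). match goal with |- @eq _ ?l ?r => change (@eq R l r) end. field. lra.
    + auto.
    + apply (is_derive_comp (fun x => Rpower x (gamma - 2)) rho); [|auto].
      replace ((gamma - 2) * (Rpower (rho t) (gamma - 2) * / rho t))
        with ((gamma - 2) * Rpower (rho t) (gamma - 2 - 1)); [apply is_derive_Rpower, Hp|].
      unfold Rminus at 2. rewrite Rpower_plus, Rpower_Ropp, Rpower_1 by exact Hp. reflexivity.
    + simpl. apply (is_derive_const (V := R_NormedModule)).
  - exact Hpos.
  - intros t Ht. pose proof (Hpos t ltac:(lra)) as Hp.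
    assert (EP : Derive (fun s : R => pressure gamma (rho s)) t =
      v t * (rho t * (gamma * Rpower (rho t) (gamma - 2)))).
    { apply is_derive_unique, (is_derive_comp (pressure gamma) rho); [apply is_derive_pressure, Hp|apply Hrho; lra]. }
    rewrite EP.
    assert (HD1 : forall x, 1 < x -> Derive rho x = v x).
    { intros x Hx. apply is_derive_unique, Hrho. lra. }
    rewrite (Derive_ext_loc (radial_laplacian (S N) rho)
      (fun t : R => / kappa * (enthalpy gamma (rho t) - enthalpy gamma rho_plus))).
    + assert (EL : Derive (fun t : R => / kappa * (enthalpy gamma (rho t) - enthalpy gamma rho_plus)) t
         = / kappa * (v t * (gamma * Rpower (rho t) (gamma - 2)) - 0)).
      { apply is_derive_unique, is_derive_scal.
        apply (is_derive_minus (V := R_NormedModule) (fun t => enthalpy gamma (rho t))); [apply Hh; lra|].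
        apply (is_derive_const (V := R_NormedModule)). }
      rewrite EL. field. lra.
    + apply Hloc; [exact Ht|]. intros x Hx. unfold radial_laplacian.
      rewrite HD1 by exact Hx. change (Derive_n rho 2 x) with (Derive (Derive rho) x).
      rewrite (Derive_ext_loc _ v) by (apply Hloc; assumption).
      rewrite (is_derive_unique _ _ _ (Hv x ltac:(lra))), S_INR. field. split; lra.
  - apply is_derive_D_in, Hrho. lra.
  - exact Hlim.
Qed.

(** Used for the enthalpy at [rho_plus] with [m = kappa s^2] below its derivative: the two
    inequalities are then the super- and subsolution conditions for barriers of height at most
    [eta]. *)
Lemma is_derive_slope_bound (f : R -> R) (x l m : R) : is_derive f x l -> m < l ->
  exists eta, 0 < eta /\ forall y, 0 <= y <= eta ->
    m * y <= f (x + y) - f x /\ m * y <= f x - f (x - y).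
Proof.
  intros Hf Hm. apply is_derive_Reals in Hf.
  destruct (Hf (l - m) ltac:(lra)) as [d Hd].
  exists (d / 2). pose proof (cond_pos d). split; [lra|]. intros y Hy.
  destruct (Req_dec y 0) as [->|Hy0].
  - rewrite Rplus_0_r, Rminus_0_r. lra.
  - pose proof (Hd y Hy0 ltac:(rewrite Rabs_pos_eq; lra)) as H1.
    pose proof (Hd (- y) ltac:(lra) ltac:(rewrite Rabs_Ropp, Rabs_pos_eq; lra)) as H2.
    apply Rabs_def2 in H1, H2.
    assert (E1 : (f (x + y) - f x) / y * y = f (x + y) - f x) by (field; lra).
    assert (E2 : (f (x + - y) - f x) / - y * y = f x - f (x - y)) by (unfold Rminus; field; lra).
    rewrite <- E1, <- E2. split; apply Rmult_le_compat_r; lra.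
Qed.

(** The retraction of the line onto [[a, b]], nonexpansive and monotone, hence preserving both
    properties that shooting requires of the nonlinearity. *)
Definition clamp (a b x : R) : R := Rmin b (Rmax a x).

Lemma clamp_bounds (a b x : R) : a <= b -> a <= clamp a b x <= b.
Proof. unfold clamp, Rmin, Rmax. destruct (Rle_dec a x); destruct (Rle_dec b _); lra. Qed.

Lemma clamp_id (a b x : R) : a <= x <= b -> clamp a b x = x.
Proof. unfold clamp. intros H. rewrite Rmax_right, Rmin_right; lra. Qed.

Lemma clamp_le (a b x y : R) : x <= y -> clamp a b x <= clamp a b y.
Proof. intros H. apply Rle_min_compat_l, Rle_max_compat_l, H. Qed.

Lemma clamp_lipschitz (a b x y : R) : a <= b -> Rabs (clamp a b x - clamp a b y) <= Rabs (x - y).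
Proof.
  intros Hab. unfold clamp, Rmin, Rmax.
  destruct (Rle_dec a x); destruct (Rle_dec a y); repeat destruct (Rle_dec b _);
    unfold Rabs; repeat destruct (Rcase_abs _); lra.
Qed.

(** The constant is the maximum of h' on the interval; [0 < a] keeps away from its singularity at 0
    when [gamma < 2]. *)
Lemma enthalpy_lipschitz (gamma a b : R) : 1 <= gamma -> 0 < a <= b ->
  exists B, 0 <= B /\ forall x y, a <= x <= b -> a <= y <= b ->
    Rabs (enthalpy gamma x - enthalpy gamma y) <= B * Rabs (x - y).
Proof.
  intros Hg Hab.
  set (dh := fun x => gamma * Rpower x (gamma - 2)).
  destruct (continuity_ab_maj dh a b ltac:(lra)) as [c [Hc _]].
  { intros x Hx. apply continuity_pt_filterlim.
    apply (continuous_scal_r gamma (fun x => Rpower x (gamma - 2))).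
    eapply is_derive_continuous, is_derive_Rpower. lra. }
  assert (Hdh : forall x, 0 <= dh x).
  { intros x. unfold dh. pose proof (Rpower_pos x (gamma - 2)). nra. }
  assert (H : forall x y, a <= x <= b -> a <= y <= b -> x <= y ->
    Rabs (enthalpy gamma y - enthalpy gamma x) <= dh c * (y - x)).
  { intros x y Hx Hy Hxy. replace (dh c * (y - x)) with (dh c * y - dh c * x) by ring.
    apply (derive_bound (enthalpy gamma) dh (fun t => dh c * t) (fun _ => dh c)); [assumption| | |].
    - intros t Ht. apply is_derive_enthalpy. lra.
    - intros t Ht. auto_derive; [trivial|ring].
    - intros t Ht. rewrite Rabs_pos_eq by apply Hdh. apply Hc. lra. }
  exists (dh c). split; [apply Hdh|]. intros x y Hx Hy.
  destruct (Rle_lt_dec x y) as [Hxy|Hxy].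
  - rewrite (Rabs_minus_sym x y), Rabs_minus_sym, (Rabs_pos_eq (y - x)) by lra. auto.
  - rewrite (Rabs_pos_eq (x - y)) by lra. apply H; lra.
Qed.

Lemma is_lim_exp_decay (rho : R -> R) (l A sigma : R) : 0 < sigma ->
  (forall t, 1 <= t -> Rabs (rho t - l) <= A * exp (- sigma * t)) -> is_lim rho p_infty l.
Proof.
  intros Hs H. apply is_lim_spec. intros eps. pose proof (cond_pos eps) as He.
  assert (HA : 0 <= A).
  { specialize (H 1 (Rle_refl 1)). pose proof (Rabs_pos (rho 1 - l)). pose proof (exp_pos (- sigma * 1)). nra. }
  (* From [exp (sigma t) > sigma t], the bound falls below [eps] once [t > A / (eps sigma)]. *)
  exists (Rmax 1 (A / (eps * sigma))). intros t Ht.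
  pose proof (Rmax_l 1 (A / (eps * sigma))). pose proof (Rmax_r 1 (A / (eps * sigma))).
  apply Rle_lt_trans with (1 := H t ltac:(lra)).
  assert (HAt : A < eps * (sigma * t)).
  { replace A with (eps * sigma * (A / (eps * sigma))) by (field; lra).
    rewrite <- Rmult_assoc. apply Rmult_lt_compat_l; [apply Rmult_lt_0_compat; lra|lra]. }
  pose proof (exp_ineq1_le (sigma * t)) as Hexp.
  apply (Rmult_lt_reg_r (exp (sigma * t))); [apply exp_pos|].
  rewrite Rmult_assoc, <- exp_plus. replace (- sigma * t + sigma * t) with 0 by ring.
  rewrite exp_0. nra.
Qed.

Lemma exp_le_mono (x y : R) : x <= y -> exp x <= exp y.
Proof. intros [H| ->]; [left; apply exp_increasing, H|apply Rle_refl]. Qed.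

(** [A <= eta] keeps the barriers where the clamp is the identity, so the trapped flow solves the
    original equation, and [eta < rho_plus] makes it positive. *)
Lemma stationary_solution_exists (N : nat) (gamma kappa rho_plus sigma eta A b : R) :
  1 <= gamma -> 0 < kappa -> 0 < rho_plus -> 0 < sigma -> 0 < eta < rho_plus ->
  (forall y, 0 <= y <= eta ->
     kappa * (sigma * sigma) * y <= enthalpy gamma (rho_plus + y) - enthalpy gamma rho_plus /\
     kappa * (sigma * sigma) * y <= enthalpy gamma rho_plus - enthalpy gamma (rho_plus - y)) ->
  0 <= A <= eta -> Rabs b <= A * sigma * exp (- sigma) ->
  exists rho, stationary_solution (S N) gamma kappa rho_plus b rho /\
    forall r, 1 <= r -> Rabs (rho r - rho_plus) <= A * exp (- sigma * r).
Proof.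
  intros Hg Hk Hrp Hs Heta Hslope HA Hb.
  set (c := clamp (rho_plus - eta) (rho_plus + eta)).
  assert (Hcb : forall x, rho_plus - eta <= c x <= rho_plus + eta) by (intros; apply clamp_bounds; lra).
  set (g := fun x => (enthalpy gamma (c (rho_plus + x)) - enthalpy gamma rho_plus) / kappa).
  assert (Hik : 0 < / kappa) by (apply Rinv_0_lt_compat, Hk).
  destruct (enthalpy_lipschitz gamma (rho_plus - eta) (rho_plus + eta) Hg ltac:(lra)) as [B [HB HBL]].
  assert (Hpsi : forall t, 1 <= t -> 0 <= A * exp (- sigma * t) <= eta).
  { intros t Ht. split; [apply Rmult_le_pos; [lra|left; apply exp_pos]|].
    apply Rle_trans with (A * 1); [|lra]. apply Rmult_le_compat_l; [lra|].
    rewrite <- exp_0. apply exp_le_mono. nra. }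
  assert (Hgid : forall x, Rabs x <= eta ->
    g x = (enthalpy gamma (rho_plus + x) - enthalpy gamma rho_plus) / kappa).
  { intros x Hx. apply Rabs_le_between in Hx. unfold g, c. rewrite clamp_id by lra. reflexivity. }
  destruct (flow_between_barriers N g (/ kappa * B) A sigma b) as [u [p [Hflow [Hp Hu]]]].
  - apply Rmult_le_pos; lra.
  - intros x y. unfold g.
    replace ((enthalpy gamma (c (rho_plus + x)) - enthalpy gamma rho_plus) / kappa -
      (enthalpy gamma (c (rho_plus + y)) - enthalpy gamma rho_plus) / kappa)
      with (/ kappa * (enthalpy gamma (c (rho_plus + x)) - enthalpy gamma (c (rho_plus + y)))) by (field; lra).
    rewrite Rabs_mult, Rabs_pos_eq, Rmult_assoc by lra. apply Rmult_le_compat_l; [lra|].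
    apply Rle_trans with (1 := HBL _ _ (Hcb _) (Hcb _)). apply Rmult_le_compat_l; [exact HB|].
    replace (x - y) with (rho_plus + x - (rho_plus + y)) by ring. apply clamp_lipschitz. lra.
  - intros x y Hxy. unfold g, Rdiv. apply Rmult_le_compat_r; [lra|].
    assert (Hcc : c (rho_plus + x) <= c (rho_plus + y)) by (apply clamp_le; lra).
    pose proof (Hcb (rho_plus + x)).
    pose proof (enthalpy_le gamma (c (rho_plus + x)) (c (rho_plus + y)) Hg ltac:(lra)). lra.
  - lra.
  - exact Hs.
  - exact Hb.
  - intros t Ht. specialize (Hpsi t Ht). destruct (Hslope _ Hpsi) as [H1 _].
    rewrite Hgid by (rewrite Rabs_pos_eq; lra).
    apply (Rmult_le_reg_l kappa); [exact Hk|].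
    replace (kappa * ((enthalpy gamma (rho_plus + A * exp (- sigma * t)) - enthalpy gamma rho_plus) / kappa))
      with (enthalpy gamma (rho_plus + A * exp (- sigma * t)) - enthalpy gamma rho_plus) by (field; lra).
    lra.
  - intros t Ht. specialize (Hpsi t Ht). destruct (Hslope _ Hpsi) as [_ H1].
    rewrite Hgid by (rewrite Rabs_Ropp, Rabs_pos_eq; lra).
    apply (Rmult_le_reg_l kappa); [exact Hk|].
    replace (kappa * ((enthalpy gamma (rho_plus + - (A * exp (- sigma * t))) - enthalpy gamma rho_plus) / kappa))
      with (enthalpy gamma (rho_plus - A * exp (- sigma * t)) - enthalpy gamma rho_plus)
      by (unfold Rminus; field; lra).
    lra.
  - exists (fun t => rho_plus + u t).
    assert (Hdecay : forall r, 1 <= r -> Rabs (rho_plus + u r - rho_plus) <= A * exp (- sigma * r)).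
    { intros r Hr. replace (rho_plus + u r - rho_plus) with (u r) by ring. auto. }
    split; [|exact Hdecay].
    assert (Hue : forall t, 1 <= t -> Rabs (u t) <= eta).
    { intros t Ht. apply Rle_trans with (1 := Hu t Ht). apply Hpsi, Ht. }
    replace b with (p 1 / 1 ^ N) by (rewrite Hp, pow1; field).
    apply (decaying_flow_stationary N gamma kappa rho_plus _ (fun t => p t / t ^ N)); [exact Hk| | | |].
    + intros t Ht. specialize (Hue t Ht). apply Rabs_le_between in Hue. lra.
    + intros t Ht. replace (p t / t ^ N) with (0 + p t / t ^ N) by ring.
      apply (is_derive_plus (V := R_NormedModule) (fun _ => rho_plus)).
      * apply (is_derive_const (V := R_NormedModule)).
      * apply (Hflow t Ht).
    + intros t Ht. destruct (Hflow t Ht) as [_ Hpd]. rewrite Hgid in Hpd by auto.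
      assert (Ht0 : t ^ N <> 0) by (apply pow_nonzero; lra).
      auto_derive.
      * repeat split; trivial. eexists; exact Hpd.
      * rewrite (Derive_eq _ _ _ Hpd). destruct N as [|N'].
        -- simpl. match goal with |- @eq _ ?l ?r => change (@eq R l r) end. field. lra.
        -- simpl pred. change (t ^ S N') with (t * t ^ N') in *.
           match goal with |- @eq _ ?l ?r => change (@eq R l r) end. field.
           assert (t ^ N' <> 0) by (apply pow_nonzero; lra). repeat split; lra.
    + apply is_lim_exp_decay with A sigma; assumption.
Qed.

Theorem theorem1p1 (n : nat) (gamma kappa rho_plus : R)
    (hn : (2 <= n)%nat) (hgamma : 1 <= gamma)
    (hkappa : 0 < kappa) (hrho_plus : 0 < rho_plus) :
  exists C : R, 0 < C /\
  forall sigma : R,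
    0 < sigma < sqrt (Derive (enthalpy gamma) rho_plus / kappa) ->
  exists delta : R, 0 < delta /\
  forall rho_b : R, Rabs rho_b < delta ->
  exists rho : R -> R,
    stationary_solution n gamma kappa rho_plus rho_b rho /\
    (forall r, 1 <= r ->
       Rabs (rho r - rho_plus) <= C * Rabs rho_b * exp (- sigma * r)) /\
    (forall rho' : R -> R,
       stationary_solution n gamma kappa rho_plus rho_b rho' ->
       forall r, 1 <= r -> rho' r = rho r).
Proof.
  destruct n as [|N]; [lia|].
  pose proof (is_derive_enthalpy gamma rho_plus hrho_plus) as Hh.
  rewrite (is_derive_unique _ _ _ Hh).
  set (l := gamma * Rpower rho_plus (gamma - 2)) in *.
  assert (Hl : 0 < l / kappa).
  { apply Rdiv_lt_0_compat; [|exact hkappa]. apply Rmult_lt_0_compat; [lra|apply Rpower_pos]. }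
  set (a := sqrt (l / kappa)).
  assert (Ha : 0 < a) by (apply sqrt_lt_R0, Hl).
  assert (Haa : a * a = l / kappa) by (apply sqrt_sqrt; lra).
  (* Chosen so that [C s exp (- s) >= 1] whenever [a / 2 <= s < a]: it equals
     [(2 s / a) exp (a - s)], a product of two factors that are at least 1. *)
  set (C := 2 / a * exp a).
  assert (HC : 0 < C).
  { apply Rmult_lt_0_compat; [apply Rdiv_lt_0_compat; lra|apply exp_pos]. }
  exists C. split; [exact HC|]. intros sigma Hsigma.
  (* Replacing [sigma] by [max sigma (a/2)] keeps [C] independent of [sigma]. *)
  set (s := Rmax sigma (a / 2)).
  assert (Hs1 : sigma <= s) by apply Rmax_l.
  assert (Hs2 : a / 2 <= s) by apply Rmax_r.
  assert (Hsa : s < a) by (apply Rmax_lub_lt; lra).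
  destruct (is_derive_slope_bound (enthalpy gamma) rho_plus l (kappa * (s * s)) Hh) as [eta [Heta Hslope]].
  { replace l with (kappa * (a * a)) by (rewrite Haa; field; lra). apply Rmult_lt_compat_l; nra. }
  (* The second bound keeps the strip inside positive densities. *)
  set (eta0 := Rmin eta (rho_plus / 2)).
  assert (Heta0 : 0 < eta0) by (apply Rmin_pos; lra).
  assert (Heta1 : eta0 <= eta) by apply Rmin_l.
  assert (Heta2 : eta0 <= rho_plus / 2) by apply Rmin_r.
  (* This makes the barrier height [C |rho_b|] at most [eta0]. *)
  exists (eta0 / C). split; [apply Rdiv_lt_0_compat; assumption|]. intros rho_b Hb.
  pose proof (Rabs_pos rho_b) as Hb0.
  destruct (stationary_solution_exists N gamma kappa rho_plus s eta0 (C * Rabs rho_b) rho_b)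
    as [rho [Hrho Hdecay]]; try assumption; try lra.
  - intros y Hy. apply Hslope. lra.
  - split; [nra|]. left. apply (Rmult_lt_compat_l C) in Hb; [|exact HC].
    replace (C * (eta0 / C)) with eta0 in Hb by (field; lra). exact Hb.
  - unfold C. replace (2 / a * exp a * Rabs rho_b * s * exp (- s))
      with (Rabs rho_b * (2 * s / a * (exp a * exp (- s)))) by (field; lra).
    rewrite <- exp_plus.
    assert (1 <= 2 * s / a).
    { apply (Rmult_le_reg_r a); [exact Ha|]. unfold Rdiv. rewrite Rmult_assoc, Rinv_l; lra. }
    pose proof (exp_ineq1_le (a + - s)).
    rewrite <- (Rmult_1_r (Rabs rho_b)) at 1. apply Rmult_le_compat_l; [exact Hb0|].
    rewrite <- (Rmult_1_r 1). apply Rmult_le_compat; lra.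
  - exists rho. split; [exact Hrho|]. split.
    + intros r Hr. apply Rle_trans with (1 := Hdecay r Hr).
      apply Rmult_le_compat_l; [nra|]. apply exp_le_mono. nra.
    + intros rho' Hrho'.
      apply (stationary_solution_unique N gamma kappa rho_plus rho_b); assumption.
Qed.
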